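(* Let $n\ge 3$, let $A\in\mathbb{R}^{n\times n}$ be nilpotent, $B\in\mathbb{R}^{n\times m}$, $D\in\mathbb{R}^{n\times p}$ with $D\neq 0$, let the pair $\{A,B\}$ be controllable, and let $0\prec Q=Q^\top\in\mathbb{R}^{p\times p}$. Let $u$ be a homogeneous controller (as defined in the context) for some $X\in\mathbb{R}^{n\times n}$ and some dilation $\mathbf{d}$ in $\mathbb{R}^n$, with associated matrices $G_{\mathbf d}$, $A_0$, $K$, degree $\mu$, and $P=X^{-1}$. Let $\mathbf{d}_\omega$ be a dilation in $\mathbb{R}^p$ such that the vector field on $\mathbb{R}^{n+p}$ $$\tilde f(x,\omega)=\begin{bmatrix}Ax+Bu(x)+D\omega\\ 0\end{bmatrix}$$ is $\tilde{\mathbf d}$-homogeneous of degree $\mu$ with respect to the dilation $\tilde{\mathbf d}(s)=\begin{bmatrix}\mathbf d(s)&0\\ 0&\mathbf d_\omega(s)\end{bmatrix}$, $s\in\mathbb{R}$, in $\mathbb{R}^{n+p}$. Then the $\mathbf d$-homogeneous ellipsoid $\varepsilon_{\mathbf d}(X^{-1})$ is invariant for the closed-loop system $\dot x=Ax+Bu(x)+D\omega(t)$ (with disturbances $\omega\in L^\infty(\mathbb{R}_+,\mathbb{R}^p)$, $\omega^\top(t)Q\omega(t)\le 1$) if and only if there exists $\beta>0$ such that $$\begin{bmatrix}A_0X+XA_0^\top+BY+Y^\top B^\top+\beta X & D\\ D^\top & -\beta Q\end{bmatrix}\preceq 0,\qquad G_{\mathbf d}X+XG_{\mathbf d}^\top\succ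 0,\qquad X\succ 0,$$ where $Y=KX\in\mathbb{R}^{m\times n}$.
   Context: **Dilations.** A (linear) dilation in $\mathbb{R}^k$ is $\mathbf d(s)=e^{sG_{\mathbf d}}$, $s\in\mathbb{R}$, where the generator $G_{\mathbf d}\in\mathbb{R}^{k\times k}$ is anti-Hurwitz ($-G_{\mathbf d}$ is Hurwitz). A vector field $g:\mathbb{R}^k\to\mathbb{R}^k$ is $\mathbf d$-homogeneous of degree $\nu$ if $g(\mathbf d(s)z)=e^{\nu s}\mathbf d(s)g(z)$ for all $z\in\mathbb{R}^k\setminus\{0\}$, $s\in\mathbb{R}$. **Canonical homogeneous norm.** For $P=P^\top\succ0$ let $\|x\|_P=\sqrt{x^\top Px}$. If $PG_{\mathbf d}+G_{\mathbf d}^\top P\succ0$ (equivalently, with $X=P^{-1}$, $G_{\mathbf d}X+XG_{\mathbf d}^\top\succ0$), then $\|0\|_{\mathbf d,P}=0$ and, for $x\ne0$, $\|x\|_{\mathbf d,P}=e^{s_x}$ where $s_x\in\mathbb{R}$ is the unique number with $\|\mathbf d(-s_x)x\|_P=1$. **Homogeneous controller.** Let $\{A,B\}$ be controllable. Let $G_0\in\mathbb{R}^{n\times n}$, $Y_0\in\mathbb{R}^{m\times n}$ be any solution of $AG_0-G_0A+BY_0=A$, $G_0B=0$ (then $G_0-I_n$ is invertible). Let $\tilde n$ be the minimal natural number with $\operatorname{rank}[B,AB,\dots,A^{\tilde n-1}B]=n$, let $\mu\in[-1,1/\tilde n]$, $G_{\mathbf d}=I_n+\mu G_0$ (which is anti-Hurwitz),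 $\mathbf d(s)=e^{sG_{\mathbf d}}$, $K_0=Y_0(G_0-I_n)^{-1}$, $A_0=A+BK_0$ (one has $A_0G_{\mathbf d}=(G_{\mathbf d}+\mu I_n)A_0$, $G_{\mathbf d}B=B$). Let $X\in\mathbb{R}^{n\times n}$, $Y\in\mathbb{R}^{m\times n}$ satisfy, for some $\rho>0$, $A_0X+XA_0^\top+BY+Y^\top B^\top+\rho(G_{\mathbf d}X+XG_{\mathbf d}^\top)=0$, $G_{\mathbf d}X+XG_{\mathbf d}^\top\succ0$, $X=X^\top\succ0$. Put $P=X^{-1}$, $K=YX^{-1}$ and $$u(x)=K_0x+\|x\|_{\mathbf d,P}^{\mu+1}K\mathbf d(-\ln\|x\|_{\mathbf d,P})x\quad(x\ne0),\qquad u(0)=0 .$$ **Ellipsoid, invariance.** $\varepsilon_{\mathbf d}(P)=\{x\in\mathbb{R}^n:\|x\|_{\mathbf d,P}\le1\}$. A disturbance $\omega$ is called admissible if $\omega\in L^\infty(\mathbb{R}_+,\mathbb{R}^p)$ and $\omega^\top(t)Q\omega(t)\le1$. The ellipsoid $\varepsilon_{\mathbf d}(P)$ is invariant for a system $\dot x=f(x,\omega)$ if, for every admissible $\omega$, every solution with $x(0)\in\varepsilon_{\mathbf d}(P)$ satisfies $x(t)\in\varepsilon_{\mathbf d}(P)$ for all $t\ge0$. $M\succ0$ ($\succeq0,\preceq0$) means symmetric positive definite (positive/negative semidefinite). *)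

(* Defs.v *)
From HB Require Import structures.
From mathcomp Require Import all_boot all_order all_algebra.
From mathcomp Require Import complex.
From mathcomp Require Import all_classical all_reals all_analysis.
Set Implicit Arguments.
Unset Strict Implicit.
Unset Printing Implicit Defensive.
Import Order.TTheory GRing.Theory Num.Theory.
Import numFieldNormedType.Exports.
Local Open Scope classical_set_scope.
Local Open Scope ring_scope.

Section Matrices.
Context {R : realType}.

Definition quad n (M : 'M[R]_n) (x : 'cV[R]_n) : R := (x^T *m M *m x) 0 0.

Definition posdef n (M : 'M[R]_n) : Prop :=
  M^T = M /\ forall x : 'cV[R]_n, x != 0 -> 0 < quad M x.

Definition negsemidef n (M : 'M[R]_n) : Prop :=
  M^T = M /\ forall x : 'cV[R]_n, quad M x <= 0.

(* `eigenvalue` uses row eigenvectors, which gives the usual spectrum. *)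
Definition hurwitz n (M : 'M[R]_n) : Prop :=
  forall z : R[i], eigenvalue (map_mx (real_complex R) M) z -> complex.Re z < 0.

Definition nilpotent_mx n (M : 'M[R]_n) : Prop := exists k : nat, M ^+ k = 0.

Definition expmx n (M : 'M[R]_n) : 'M[R]_n :=
  limn (series (fun k : nat => (k`!%:R)^-1 *: M ^+ k)).

(* [B, AB, ..., A^(k-1) B] *)
Definition kalman_mx n m (A : 'M[R]_n) (B : 'M[R]_(n, m)) (k : nat) :=
  \mxrow_(j < k) (A ^+ j *m B).

Definition controllable n m (A : 'M[R]_n) (B : 'M[R]_(n, m)) : Prop :=
  \rank (kalman_mx A B n) = n.

Definition controllability_index n m (A : 'M[R]_n) (B : 'M[R]_(n, m))
    (k : nat) : Prop :=
  \rank (kalman_mx A B k) = n /\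
  forall j : nat, \rank (kalman_mx A B j) = n -> (k <= j)%N.

End Matrices.

Section Homogeneity.
Context {R : realType}.

Definition anti_hurwitz n (G : 'M[R]_n) : Prop := hurwitz (- G).

Definition dilation n (G : 'M[R]_n) (s : R) : 'M[R]_n := expmx (s *: G).

Definition is_dilation n (d : R -> 'M[R]_n) : Prop :=
  exists2 G : 'M[R]_n, anti_hurwitz G & d = dilation G.

Definition homogeneous_field n (d : R -> 'M[R]_n) (nu : R)
    (g : 'cV[R]_n -> 'cV[R]_n) : Prop :=
  forall (z : 'cV[R]_n) (s : R), z != 0 ->
    g (d s *m z) = expR (nu * s) *: (d s *m g z).

Definition wnorm n (P : 'M[R]_n) (x : 'cV[R]_n) : R := Num.sqrt (quad P x).

(* The number s_x is picked by `xget`; it exists and is unique as soon as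
   P > 0 and P G + G^T P > 0, where G is the generator of d. *)
Definition hnorm n (d : R -> 'M[R]_n) (P : 'M[R]_n) (x : 'cV[R]_n) : R :=
  if x == 0 then 0
  else expR (xget 0 [set s : R | wnorm P (d (- s) *m x) = 1]).

Definition hellipsoid n (d : R -> 'M[R]_n) (P : 'M[R]_n) : set 'cV[R]_n :=
  [set x | hnorm d P x <= 1].

End Homogeneity.

Section Controller.
Context {R : realType} (n m : nat).
Implicit Types (A X : 'M[R]_n) (B : 'M[R]_(n, m)) (Y : 'M[R]_(m, n)).
Implicit Type mu : R.

Definition gen_d mu (G0 : 'M[R]_n) : 'M[R]_n := 1%:M + mu *: G0.

Definition gain_K0 (G0 : 'M[R]_n) (Y0 : 'M[R]_(m, n)) : 'M[R]_(m, n) := Y0 *m invmx (G0 - 1%:M).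

Definition mat_A0 A B (G0 : 'M[R]_n) (Y0 : 'M[R]_(m, n)) : 'M[R]_n := A + B *m gain_K0 G0 Y0.

Definition gain_K X Y : 'M[R]_(m, n) := Y *m invmx X.

Record homogeneous_design A B (G0 : 'M[R]_n) (Y0 : 'M[R]_(m, n)) mu X Y : Prop := HomogeneousDesign {
  design_sylvester : A *m G0 - G0 *m A + B *m Y0 = A ;
  design_G0B : G0 *m B = 0 ;
  design_degree : exists2 k : nat,
    controllability_index A B k & -1 <= mu <= k%:R^-1 ;
  design_lyapunov : exists2 rho : R, 0 < rho &
    let A0 := mat_A0 A B G0 Y0 in
    A0 *m X + X *m A0^T + B *m Y + Y^T *m B^T
      + rho *: (gen_d mu G0 *m X + X *m (gen_d mu G0)^T) = 0 ;
  design_monotone : posdef (gen_d mu G0 *m X + X *m (gen_d mu G0)^T) ;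
  design_X : posdef X
}.

Definition homogeneous_control (G0 : 'M[R]_n) (Y0 : 'M[R]_(m, n)) mu X Y
    (x : 'cV[R]_n) : 'cV[R]_m :=
  if x == 0 then 0 else
  let d := dilation (gen_d mu G0) in
  let r := hnorm d (invmx X) x in
  gain_K0 G0 Y0 *m x
    + powR r (mu + 1) *: (gain_K X Y *m d (- ln r) *m x).

End Controller.

Section Invariance.
Context {R : realType} (n p : nat).

Definition plant m (A : 'M[R]_n) (B : 'M[R]_(n, m)) (D : 'M[R]_(n, p))
    (u : 'cV[R]_n -> 'cV[R]_m) (x : 'cV[R]_n) (w : 'cV[R]_p) : 'cV[R]_n :=
  A *m x + B *m u x + D *m w.

(* The vector field (x, w) |-> (f x w, 0) on R^(n + p). *)
Definition extended_field (f : 'cV[R]_n -> 'cV[R]_p -> 'cV[R]_n)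
    (z : 'cV[R]_(n + p)) : 'cV[R]_(n + p) :=
  col_mx (f (usubmx z) (dsubmx z)) 0.

(* A disturbance on R_+ is a function on R whose values at negative times are
   irrelevant; as for any element of L^oo, the pointwise bound holds almost
   everywhere. *)
Definition admissible (Q : 'M[R]_p) (w : R -> 'cV[R]_p) : Prop :=
  (forall i : 'I_p,
     (fun t => w t i 0) \_ `[0, +oo[ \in Lfun lebesgue_measure +oo%E) /\
  {ae lebesgue_measure, forall t : R, 0 <= t -> quad Q (w t) <= 1}.

(* Caratheodory solution of x' = f (x, w t) on the interval [0, T[, in integral
   form: x is locally absolutely continuous and satisfies the equation almost
   everywhere. *)
Definition solution (f : 'cV[R]_n -> 'cV[R]_p -> 'cV[R]_n)
    (w : R -> 'cV[R]_p) (T : \bar R) (x : R -> 'cV[R]_n) : Prop :=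
  forall (t : R) (i : 'I_n), 0 <= t -> (t%:E < T)%E ->
    lebesgue_measure.-integrable `[0, t]
      (fun s : R => (f (x s) (w s) i 0)%:E) /\
    x t i 0 = x 0 i 0 + \int[lebesgue_measure]_(s in `[0, t]) f (x s) (w s) i 0.

(* Solutions need not extend to the whole half-line, so all intervals [0, T[
   with 0 < T <= +oo are considered. *)
Definition invariant_for (f : 'cV[R]_n -> 'cV[R]_p -> 'cV[R]_n)
    (Q : 'M[R]_p) (E : set 'cV[R]_n) : Prop :=
  forall (w : R -> 'cV[R]_p) (T : \bar R) (x : R -> 'cV[R]_n),
    admissible Q w -> (0 < T)%E -> solution f w T x -> E (x 0) ->
    forall t : R, 0 <= t -> (t%:E < T)%E -> E (x t).

End Invariance.

(* Main.v *)
Require Import Defs.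
From mathcomp Require Import all_boot all_order all_algebra.
From mathcomp Require Import ring lra.
From mathcomp Require Import all_classical all_reals all_analysis ess_sup_inf.
Set Implicit Arguments.
Unset Strict Implicit.
Unset Printing Implicit Defensive.
Import Order.TTheory GRing.Theory Num.Theory.
Import numFieldNormedType.Exports.
Local Open Scope classical_set_scope.
Local Open Scope ring_scope.

(** Let [P = X^-1]. By monotonicity of the dilation the homogeneous ellipsoid is
    the ordinary ellipsoid [x^T P x <= 1], and on its boundary the homogeneous
    norm is [1], so the closed loop reads [(A0 + B K) x + D w] there. The
    logarithm of the homogeneous norm, hence the feedback, is Lipschitz in an
    annulus around the boundary.

    For such a field, invariance means that the speed [x^T P f(x, w)] is
    nonpositive on the boundary for all admissible values [w]. If it is, then
    [phi = x^T P x - 1] satisfies [phi' <= C phi] outside, so it cannot leave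
    [0]; as solutions are only Caratheodory, this is run on increments,
    [phi b - phi a <= C (b - a) sup phi + C' (b - a)^2]. If it is not,
    the solution with constant [w], given by Picard iteration, leaves.

    With [xi = P x] and by scaling, the speed condition says that
    [w^T Q w <= xi^T X xi] implies [xi^T S xi + 2 xi^T D w <= 0], where [S] is the
    Lyapunov expression of the matrix inequality. The S-lemma turns this into the
    matrix inequality; its multiplier is nonzero because [D <> 0]. *)

(** * Bilinear and quadratic forms *)

Section BilinearForms.
Context {R : realType}.

(** The two arguments may have different dimensions, so that the coupling term [x^T D w] between
    state and disturbance is covered. *)
Definition bil m n (M : 'M[R]_(m, n)) (x : 'cV[R]_m) (y : 'cV[R]_n) : R :=
  (x^T *m M *m y) 0 0.

Lemma quadE n (M : 'M[R]_n) x : quad M x = bil M x x.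
Proof. by []. Qed.

Lemma bilDl m n (M : 'M[R]_(m, n)) x x' y :
  bil M (x + x') y = bil M x y + bil M x' y.
Proof. by rewrite /bil linearD /= !mulmxDl mxE. Qed.

Lemma bilDr m n (M : 'M[R]_(m, n)) x y y' :
  bil M x (y + y') = bil M x y + bil M x y'.
Proof. by rewrite /bil mulmxDr mxE. Qed.

Lemma bilZl m n (M : 'M[R]_(m, n)) a x y : bil M (a *: x) y = a * bil M x y.
Proof. by rewrite /bil linearZ /= -!scalemxAl mxE. Qed.

Lemma bilZr m n (M : 'M[R]_(m, n)) a x y : bil M x (a *: y) = a * bil M x y.
Proof. by rewrite /bil -scalemxAr mxE. Qed.

Lemma bilNl m n (M : 'M[R]_(m, n)) x y : bil M (- x) y = - bil M x y.
Proof. by rewrite -scaleN1r bilZl mulN1r. Qed.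

Lemma bilNr m n (M : 'M[R]_(m, n)) x y : bil M x (- y) = - bil M x y.
Proof. by rewrite -scaleN1r bilZr mulN1r. Qed.

Lemma bilBl m n (M : 'M[R]_(m, n)) x x' y :
  bil M (x - x') y = bil M x y - bil M x' y.
Proof. by rewrite bilDl bilNl. Qed.

Lemma bilBr m n (M : 'M[R]_(m, n)) x y y' :
  bil M x (y - y') = bil M x y - bil M x y'.
Proof. by rewrite bilDr bilNr. Qed.

Lemma bil_tr m n (M : 'M[R]_(m, n)) x y : bil M x y = bil M^T y x.
Proof.
by rewrite /bil -[LHS]/((x^T *m M *m y) 0 0) -[in LHS](trmxK (_ *m y)) mxE
  !trmx_mul trmxK mulmxA.
Qed.

Lemma bilC n (M : 'M[R]_n) x y : M^T = M -> bil M x y = bil M y x.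
Proof. by move=> sM; rewrite bil_tr sM. Qed.

Lemma bil_mulmx m n k l (M : 'M[R]_(m, n)) (U : 'M[R]_(m, k)) (V : 'M[R]_(n, l))
  x y : bil M (U *m x) (V *m y) = bil (U^T *m M *m V) x y.
Proof. by rewrite /bil trmx_mul !mulmxA. Qed.

Lemma bil_mulmxr m n k (M : 'M[R]_(m, n)) (V : 'M[R]_(n, k)) x y :
  bil M x (V *m y) = bil (M *m V) x y.
Proof. by rewrite /bil !mulmxA. Qed.

Lemma bil_mxD m n (M N : 'M[R]_(m, n)) x y :
  bil (M + N) x y = bil M x y + bil N x y.
Proof. by rewrite /bil mulmxDr mulmxDl mxE. Qed.

Lemma bil_mxZ m n a (M : 'M[R]_(m, n)) x y : bil (a *: M) x y = a * bil M x y.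
Proof. by rewrite /bil -scalemxAr -scalemxAl mxE. Qed.

Lemma bil_mxN m n (M : 'M[R]_(m, n)) x y : bil (- M) x y = - bil M x y.
Proof. by rewrite -scaleN1r bil_mxZ mulN1r. Qed.

Lemma bil_mx0 m n x y : bil (0 : 'M[R]_(m, n)) x y = 0.
Proof. by rewrite /bil mulmx0 mul0mx mxE. Qed.

Lemma quadD n (M : 'M[R]_n) x y : M^T = M ->
  quad M (x + y) = quad M x + 2 * bil M x y + quad M y.
Proof.
by move=> sM; rewrite !quadE !bilDl !bilDr (bilC y x sM); ring.
Qed.

Lemma quadZ n (M : 'M[R]_n) a x : quad M (a *: x) = a ^+ 2 * quad M x.
Proof. by rewrite !quadE bilZl bilZr; ring. Qed.

Lemma quad0 n (M : 'M[R]_n) : quad M 0 = 0.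
Proof. by rewrite /quad mulmx0 mxE. Qed.

Lemma quad_ge0 n (M : 'M[R]_n) x : posdef M -> 0 <= quad M x.
Proof.
move=> [_ Mpos]; have [->|x0] := eqVneq x 0; first by rewrite quad0.
exact/ltW/Mpos.
Qed.

(** The form at [(y^T M y) x - (x^T M y) y] is nonnegative, and it equals [y^T M y] times the
    difference of the two sides. *)
Lemma posdef_CauchySchwarz n (M : 'M[R]_n) x y : posdef M ->
  bil M x y ^+ 2 <= quad M x * quad M y.
Proof.
move=> Mpd; have [->|y0] := eqVneq y 0.
  by rewrite quad0 mulr0 /bil mulmx0 mxE expr0n.
have qy : 0 < quad M y by apply: Mpd.2.
have := quad_ge0 (quad M y *: x - bil M x y *: y) Mpd.
have sM := Mpd.1.
rewrite quadD // -scaleNr !quadZ bilZl bilZr => h.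
have : 0 <= quad M y * (quad M x * quad M y - bil M x y ^+ 2).
  by apply: le_trans h _; rewrite le_eqVlt; apply/orP; left; apply/eqP; ring.
by rewrite pmulr_rge0 // subr_ge0.
Qed.

Lemma posdef_unitmx n (M : 'M[R]_n) : posdef M -> M \in unitmx.
Proof.
move=> Mpd; rewrite -row_free_unit -kermx_eq0; apply/negPn/negP => /rowV0Pn.
move=> [v /sub_kermxP vM v0].
have := Mpd.2 v^T; rewrite trmx_eq0 => /(_ v0).
by rewrite /quad trmxK vM mul0mx mxE ltxx.
Qed.

End BilinearForms.

(** * The max norm of matrices and its comparison with quadratic forms *)

Section MatrixNorm.
Context {R : realType}.

Lemma le_mx_norm m n (A : 'M[R]_(m, n)) i j : `|A i j| <= `|A|.
Proof.
by rewrite [leRHS]/Num.Def.normr /= mx_normrE; apply/bigmax_geP; right; exists (i, j).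
Qed.

Lemma mx_norm_le m n (A : 'M[R]_(m, n)) c :
  0 <= c -> (forall i j, `|A i j| <= c) -> `|A| <= c.
Proof.
move=> c0 Ac; rewrite [leLHS]/Num.Def.normr /= mx_normrE.
by apply/bigmax_leP; split => // -[i j] _; exact: Ac.
Qed.

(** The norm is the largest absolute value of an entry, whence the inner dimension as a factor. *)
Lemma mx_norm_mulmx m n p (A : 'M[R]_(m, n)) (B : 'M[R]_(n, p)) :
  `|A *m B| <= n%:R * `|A| * `|B|.
Proof.
apply: mx_norm_le => [|i j]; first by rewrite !mulr_ge0.
rewrite mxE (le_trans (ler_norm_sum _ _ _)) //.
rewrite -[n in n%:R]card_ord -mulrA mulr_natl -sumr_const ler_sum // => k _.
by rewrite normrM ler_pM // le_mx_norm.
Qed.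

Lemma mx_norm_tr m n (A : 'M[R]_(m, n)) : `|A^T| = `|A|.
Proof.
apply/eqP; rewrite eq_le; apply/andP; split; apply: mx_norm_le => // i j.
  by rewrite mxE le_mx_norm.
by have := le_mx_norm A^T j i; rewrite mxE.
Qed.

Lemma bil_le m n (M : 'M[R]_(m, n)) :
  exists2 C, 0 < C & forall x y, `|bil M x y| <= C * `|x| * `|y|.
Proof.
(* Adding 1 keeps the constant positive even if [M] is zero; the same device recurs below. *)
exists (n%:R * (m%:R * `|M|) + 1) => [|x y].
  by rewrite ltr_wpDl // !mulr_ge0.
rewrite /bil (le_trans (le_mx_norm _ _ _)) //.
rewrite (le_trans (mx_norm_mulmx _ _)) // ler_wpM2r //.
have := mx_norm_mulmx x^T M; rewrite mx_norm_tr => h.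
have n0 : 0 <= n%:R :> R by [].
have := ler_wpM2l n0 h; have := normr_ge0 x => x0 h'.
by apply: le_trans h' _; rewrite mulrDl mul1r !mulrA -!(mulrAC _ `|x|) lerDl.
Qed.

(* Each coordinate is the M-inner product with a fixed vector. *)
Lemma posdef_coercive n (M : 'M[R]_n) : posdef M ->
  exists2 C, 0 < C & forall x, `|x| ^+ 2 <= C * quad M x.
Proof.
move=> Mpd; pose e (i : 'I_n) : 'cV[R]_n := invmx M *m delta_mx i 0.
have He i (x : 'cV[R]_n) : x i 0 = bil M (e i) x.
  have sM := Mpd.1; rewrite (bilC _ _ sM) /bil /e mulmxA.
  rewrite mulmxK ?posdef_unitmx //.
  by rewrite -colE !mxE.
exists (\sum_i quad M (e i) + 1) => [|x].
  by rewrite ltr_wpDl // sumr_ge0 // => i _; apply: quad_ge0.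
have C0 : 0 <= (\sum_i quad M (e i) + 1) * quad M x.
  by rewrite mulr_ge0 ?quad_ge0 // addr_ge0 // sumr_ge0 // => i _; apply: quad_ge0.
rewrite -[leRHS]sqr_sqrtr // ler_pXn2r ?nnegrE ?sqrtr_ge0 //.
apply: mx_norm_le => [|i j]; first exact: sqrtr_ge0.
rewrite (ord1 j) -[leLHS]sqrtr_sqr ler_sqrt //.
rewrite He (le_trans (posdef_CauchySchwarz _ _ Mpd)) // ler_wpM2r ?quad_ge0 //.
rewrite (bigD1 i) //= -addrA lerDl addr_ge0 // sumr_ge0 // => k _.
exact: quad_ge0.
Qed.

Lemma quad_le_posdef n (M H : 'M[R]_n) : posdef H ->
  exists2 C, 0 < C & forall x, `|quad M x| <= C * quad H x.
Proof.
move=> /posdef_coercive[c c0 cH]; have [b b0 bM] := bil_le M.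
exists (b * c) => [|x]; first exact: mulr_gt0.
by rewrite (le_trans (bM x x)) // -!mulrA ler_pM2l // -expr2.
Qed.

End MatrixNorm.

(** * The S-lemma for two quadratic forms *)

(* If no multiplier existed, some [t] would make [F + t G] positive at a point
   with [G > 0] and at one with [G < 0]. Up to the sign of one of them, [F + t G]
   is then positive on the whole segment, which meets [G = 0]. *)
Section SLemma.
Context {R : realType} (n : nat).
Variables F G : 'M[R]_n.
Hypotheses (symF : F^T = F) (symG : G^T = G).
Hypothesis FG : forall z, 0 <= quad G z -> quad F z <= 0.

(** One of [a] and [1 - a] is at least 1/2, and its square carries a positive coefficient. *)
Lemma segment_gt0 (a h b k : R) : 0 <= a -> a <= 1 -> 0 < h -> 0 <= b ->
  0 < k -> 0 < (1 - a) ^+ 2 * h + 2 * (a * (1 - a)) * b + a ^+ 2 * k.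
Proof.
clear => a0 a1 h0 b0 k0; have a1' : 0 <= 1 - a by rewrite subr_ge0.
have hb : 0 <= 2 * (a * (1 - a)) * b by rewrite !mulr_ge0.
have [a12|a12] := leP a (1 / 2).
  have : 0 < (1 - a) ^+ 2 * h by rewrite mulr_gt0 // exprn_gt0; lra.
  have : 0 <= a ^+ 2 * k by rewrite mulr_ge0 ?sqr_ge0 // ltW.
  lra.
have : 0 <= (1 - a) ^+ 2 * h by rewrite mulr_ge0 ?sqr_ge0 // ltW.
have : 0 < a ^+ 2 * k by rewrite mulr_gt0 // exprn_gt0; lra.
lra.
Qed.

Lemma quad_segment (M : 'M[R]_n) (a : R) x y : M^T = M ->
  quad M ((1 - a) *: x + a *: y) =
  (1 - a) ^+ 2 * quad M x + 2 * (a * (1 - a)) * bil M x y + a ^+ 2 * quad M y.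
Proof. by move=> sM; rewrite quadD // !quadZ bilZl bilZr; ring. Qed.

Lemma no_positive_pencil t x y : quad G x < 0 -> 0 < quad G y ->
  0 < quad (F + t *: G) x -> 0 < quad (F + t *: G) y -> False.
Proof.
pose H := F + t *: G.
have symH : H^T = H by rewrite /H linearD linearZ /= symF symG.
(* Replacing [x] by [- x] keeps the quadratic forms and changes the sign of the cross term. *)
wlog b0 : x / 0 <= bil H x y => [wl|] Gx Gy Hx Hy.
  have [b0|b0] := leP 0 (bil H x y); first exact: (wl x).
  have N1 M : quad M (- x) = quad M x :> R by rewrite !quadE bilNl bilNr opprK.
  by apply: (wl (- x)); rewrite ?N1 // bilNl oppr_ge0 ltW.
(* [p] is the form of [G] along the segment from [x] to [y]. It changes sign, so it has a root;
   there [H] and [F] agree, and [FG] contradicts the positivity of [H]. *)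
pose p : {poly R} := quad G x *: (1 - 'X) ^+ 2 +
  (2 * bil G x y) *: ('X * (1 - 'X)) + quad G y *: 'X ^+ 2.
have pE a : p.[a] = quad G ((1 - a) *: x + a *: y).
  by rewrite quad_segment // /p !hornerE /=; ring.
have [||a a01 /rootP pa] := @poly_ivt R p 0 1; rewrite ?ler01 //.
  by rewrite !pE !(subr0, subrr) !(scale0r, scale1r) addr0 add0r !ltW.
have /andP[a0 a1] := a01.
have : 0 < quad H ((1 - a) *: x + a *: y).
  by rewrite quad_segment //; exact: segment_gt0.
rewrite quadE bil_mxD bil_mxZ -!quadE -pE pa mulr0 addr0 ltNge.
by rewrite FG // -pE pa.
Qed.

Lemma S_lemma : (exists z, 0 < quad G z) ->
  exists2 b, 0 <= b & forall z, quad F z + b * quad G z <= 0.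
Proof.
move=> [z0 Gz0].
(* Points with [G > 0] bound the multiplier from above by these ratios, points with [G < 0] bound it
   from below. The infimum of the upper bounds is taken. *)
pose S := [set r : R | exists2 z, 0 < quad G z & r = - quad F z / quad G z].
have S0 : S !=set0 by exists (- quad F z0 / quad G z0); exists z0.
have lbS0 : lbound S 0.
  by move=> _ [z Gz ->]; rewrite divr_ge0 ?oppr_ge0 ?FG ?ltW.
exists (inf S) => [|z]; first exact: lb_le_inf.
have [Gz|Gz|Gz] := ltgtP (quad G z) 0; last by rewrite Gz mulr0 addr0 FG // Gz.
- suff : quad F z / - quad G z <= inf S.
    rewrite ler_pdivrMr ?oppr_gt0 //; lra.
  apply: lb_le_inf => // _ [y Gy ->]; rewrite leNgt; apply/negP => lt_ratio.
  (* If a lower bound exceeded an upper bound, any [t] strictly between them would make [F + t G]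
     positive at both points. *)
  pose t := (- quad F y / quad G y + quad F z / - quad G z) / 2.
  have Gy' : quad G y != 0 by rewrite gt_eqF.
  have Gz' : - quad G z != 0 by rewrite oppr_eq0 lt_eqF.
  apply: (@no_positive_pencil t z y) => //.
    rewrite quadE bil_mxD bil_mxZ -!quadE.
    have : t < quad F z / - quad G z by rewrite /t; lra.
    by rewrite ltr_pdivlMr ?oppr_gt0 //; lra.
  rewrite quadE bil_mxD bil_mxZ -!quadE.
  have : - quad F y / quad G y < t by rewrite /t; lra.
  by rewrite ltr_pdivrMr //; lra.
- have : inf S <= - quad F z / quad G z.
    by apply: ge_inf; [exists 0 | exists z].
  by rewrite ler_pdivlMr //; lra.
Qed.

End SLemma.

(** * The matrix exponential as an entrywise power series *)

Section MatrixExponential.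
Context {R : realType}.

Lemma mx_norm1_le n : `|1%:M : 'M[R]_n| <= 1.
Proof. by apply: mx_norm_le => // i j; rewrite mxE; case: eqP; rewrite ?normr1 ?normr0. Qed.

Lemma mx_norm_exp n (M : 'M[R]_n) k : `|M ^+ k| <= (n%:R * `|M|) ^+ k.
Proof.
elim: k => [|k IH]; first by rewrite !expr0 mx_norm1_le.
rewrite !exprS (le_trans (mx_norm_mulmx _ _)) // ler_wpM2l // mulr_ge0.
Qed.

Lemma scalemx_exp n (M : 'M[R]_n) (s : R) k : (s *: M) ^+ k = s ^+ k *: M ^+ k.
Proof.
elim: k => [|k IH]; first by rewrite !expr0 scale1r.
by rewrite !exprS IH -!mulmxE -scalemxAl -scalemxAr scalerA.
Qed.

Lemma cvg_mx m n (u : nat -> 'M[R]_(m, n)) (l : 'M[R]_(m, n)) :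
  (forall i j, u k i j @[k --> \oo] --> l i j) -> u @ \oo --> l.
Proof.
move=> ul; apply/cvgrPdist_le => e e0.
have : \forall k \near \oo, forall ij : 'I_m * 'I_n,
    `|l ij.1 ij.2 - u k ij.1 ij.2| <= e.
  apply: filter_forall => -[i j] /=.
  by have /cvgrPdist_le := ul i j; apply.
apply: filterS => k H; apply: mx_norm_le => [|i j]; first exact: ltW.
by rewrite !mxE; exact: (H (i, j)).
Qed.

(** These are the coefficients, as a power series in [s], of the entry [i, j] of [M^a exp(s M)]. The
    shift [a] makes the family stable under termwise differentiation. *)
Definition exp_entry n (M : 'M[R]_n) a i j (k : nat) : R :=
  (k`!%:R)^-1 * (M ^+ (a + k)) i j.

(** With [r = n |M|], the series is dominated by [r^a] times the exponential series at [r |s|]. *)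
Lemma exp_entry_cvg n (M : 'M[R]_n) a i j s :
  cvgn (pseries (exp_entry M a i j) s).
Proof.
apply: normed_cvg.
pose r := n%:R * `|M|.
have r0 : 0 <= r by exact: mulr_ge0.
apply: (@series_le_cvg _ _ (fun k => r ^+ a * exp_coeff (r * `|s|) k)) => //.
- by move=> k /=.
- by move=> k; rewrite /exp_coeff /= !(mulr_ge0, exprn_ge0, invr_ge0).
- move=> k; rewrite /exp_entry /exp_coeff /= !normrM normrX normfV normr_nat.
  rewrite (exprMn k r) [leRHS](_ : _ =
    (k`!%:R)^-1 * (r ^+ (a + k) * `|s| ^+ k)); last by rewrite exprD; ring.
  rewrite -mulrA ler_wpM2l // ler_wpM2r ?exprn_ge0 //.
  exact: le_trans (le_mx_norm _ _ _) (mx_norm_exp _ _).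
- exact/is_cvg_seriesZ/is_cvg_series_exp_coeff.
Qed.

Lemma expmx_series_cvg n (M : 'M[R]_n) (s : R) :
  series (fun k : nat => (k`!%:R)^-1 *: (s *: M) ^+ k) @ \oo -->
  \matrix_(i, j) limn (pseries (exp_entry M 0 i j) s).
Proof.
apply: cvg_mx => i j; rewrite mxE.
rewrite (_ : (fun k => _) = pseries (exp_entry M 0 i j) s); last first.
  apply/funext => N; rewrite /series /= summxE; apply: eq_bigr => k _.
  by rewrite /exp_entry /= add0n scalemx_exp !mxE; ring.
exact: exp_entry_cvg.
Qed.

Lemma dilation_entry n (M : 'M[R]_n) s i j :
  dilation M s i j = limn (pseries (exp_entry M 0 i j) s).
Proof.
by rewrite /dilation /expmx (cvg_lim _ (@expmx_series_cvg _ M s)) // mxE.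
Qed.

Lemma dilation0 n (M : 'M[R]_n) : dilation M 0 = 1%:M.
Proof.
apply/matrixP => i j; rewrite dilation_entry; apply: cvg_lim => //.
apply: cvg_near_cst; exists 1%N => // -[//|N] _.
rewrite /pseries /series /= big_nat_recl // big1 => [|k _].
  by rewrite addr0 /exp_entry /= fact0 invr1 mul1r addn0 !expr0 mulr1.
by rewrite expr0n /= mulr0.
Qed.

Lemma exp_entry_diffs n (M : 'M[R]_n) a i j :
  pseries_diffs (exp_entry M a i j) = exp_entry M a.+1 i j.
Proof.
apply/funext => k; rewrite /pseries_diffs /exp_entry factS addnS addSn natrM.
by rewrite invfM !mulrA mulfV // mul1r.
Qed.

Lemma dilation_derive n (M : 'M[R]_n) (s : R) i j :
  is_derive s (1 : R) (fun t => dilation M t i j) ((M *m dilation M s) i j).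
Proof.
rewrite (_ : (fun t => _) = fun t => limn (pseries (exp_entry M 0 i j) t));
  last by apply/funext => t; rewrite dilation_entry.
have -> : (M *m dilation M s) i j =
    limn (pseries (pseries_diffs (exp_entry M 0 i j)) s).
  apply/esym/cvg_lim => //; rewrite exp_entry_diffs mxE.
  rewrite (_ : pseries _ _ = fun N =>
    \sum_k M i k * pseries (exp_entry M 0 k j) s N).
    apply: cvg_big => [|k _]; first exact: add_continuous.
    by apply: cvgMr; rewrite dilation_entry; exact: exp_entry_cvg.
  apply/funext => N; rewrite /pseries /series /=.
  under [RHS]eq_bigr do rewrite mulr_sumr.
  rewrite exchange_big /=; apply: eq_bigr => k _.
  rewrite /exp_entry add1n add0n exprS -mulmxE mxE mulr_sumr mulr_suml.
  by apply: eq_bigr => l _; ring.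
(* Termwise differentiation at [s] asks that the series and its first two formal derivatives
   converge at a point of larger modulus; [|s| + 1] is one. *)
have h a : cvgn (pseries (exp_entry M a i j) (`|s| + 1)) by exact: exp_entry_cvg.
apply: (@pseries_snd_diffs _ _ (`|s| + 1)); rewrite ?exp_entry_diffs //.
by rewrite (ger0_norm (addr_ge0 _ _)) // ltrDl.
Qed.

End MatrixExponential.

(** * Bounds and Lipschitz estimates from derivatives, and their use for dilations *)

Section RealFunctions.
Context {R : realType}.

Lemma finite_bound (I : finType) (T : Type) (Q : T -> Prop) (f : I -> T -> R) :
  (forall i, exists C, forall x, Q x -> f i x <= C) ->
  exists2 C, 0 < C & forall i x, Q x -> f i x <= C.
Proof.
move=> /boolp.choice[C fC]; exists (\sum_i `|C i| + 1).
  by rewrite ltr_wpDl // sumr_ge0.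
move=> i x Qx; rewrite (le_trans (fC i x Qx)) // (le_trans (ler_norm _)) //.
by rewrite (bigD1 i) //= -addrA lerDl addr_ge0 // sumr_ge0.
Qed.

Lemma is_derive_continuous (f df : R -> R) :
  (forall x : R, is_derive x (1 : R) f (df x)) -> continuous f.
Proof.
by move=> fd x; apply/differentiable_continuous/derivable1_diffP; case: (fd x).
Qed.

Lemma is_derive_nonincreasing (f df : R -> R) a b :
  (forall x : R, is_derive x (1 : R) f (df x)) -> (forall x, df x <= 0) ->
  a <= b -> f b <= f a.
Proof.
move=> fd df0; rewrite le_eqVlt => /predU1P[->//|ab].
have [|c _ fE] := MVT ab (fun x _ => fd x).
  exact/continuous_subspaceT/is_derive_continuous.
by rewrite -subr_le0 fE mulr_le0_ge0 // subr_ge0 ltW.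
Qed.

Lemma is_derive_lipschitz (f df : R -> R) S K :
  (forall x : R, is_derive x (1 : R) f (df x)) ->
  (forall x, `|x| <= S -> `|df x| <= K) ->
  forall s t, `|s| <= S -> `|t| <= S -> `|f s - f t| <= K * `|s - t|.
Proof.
move=> fd dfK; have cf := is_derive_continuous fd.
have wl s t : `|s| <= S -> `|t| <= S -> t < s -> `|f s - f t| <= K * `|s - t|.
  move=> sS tS st; have := sS; have := tS.
  rewrite (ler_norml t) (ler_norml s) => /andP[t1 t2] /andP[s1 s2].
  have [|c cst ->] := MVT st (fun x _ => fd x); first exact/continuous_subspaceT.
  rewrite normrM ler_wpM2r // dfK //.
  by move: cst; rewrite in_itv /= => /andP[? ?]; rewrite ler_norml; lra.
move=> s t sS tS; have [st|st|->] := ltgtP s t; last by rewrite !subrr !normr0 mulr0.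
  by rewrite distrC (distrC s); exact: wl.
exact: wl.
Qed.

Lemma continuous_bounded (f : R -> R) S : continuous f ->
  exists C, forall x, `|x| <= S -> `|f x| <= C.
Proof.
move=> cf; have [S0|S0] := ltP S 0.
  by exists 0 => x xS; have := normr_ge0 x; lra.
have cnf : {within `[- S, S], continuous (fun x => `|f x|)}.
  by apply: continuous_subspaceT => x; apply: continuous_comp (cf x) _; exact: norm_continuous.
have [|c _ fc] := @EVT_max R (fun x => `|f x|) (- S) S _ cnf; first lra.
by exists `|f c| => x; rewrite ler_norml => xS; apply: fc; rewrite in_itv.
Qed.

Lemma derive_mulmxr m n p (Y dY : R -> 'M[R]_(m, n)) (N : 'M[R]_(n, p)) (s : R) :
  (forall i j, is_derive s (1 : R) (fun t => Y t i j) (dY s i j)) ->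
  forall i j, is_derive s (1 : R) (fun t => (Y t *m N) i j) ((dY s *m N) i j).
Proof.
move=> Yd i j; rewrite mxE.
rewrite (_ : (fun t => _) = \sum_k (fun t => Y t i k * N k j)); last first.
  by apply/funext => t; rewrite mxE fct_sumE.
apply: is_derive_sum => k.
have := @is_deriveM _ _ (fun t => Y t i k) (cst (N k j)) s 1 _ _ (Yd i k) (is_derive_cst _ _ _).
by move=> /is_derive_eq; apply; rewrite /GRing.scale /=; ring.
Qed.

Lemma derive_quad n (M : 'M[R]_n) (y dy : R -> 'cV[R]_n) (s : R) : M^T = M ->
  (forall i, is_derive s (1 : R) (fun t => y t i 0) (dy s i 0)) ->
  is_derive s (1 : R) (fun t => quad M (y t)) (2 * bil M (y s) (dy s)).
Proof.
move=> sM yd.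
have bilE (u v : 'cV[R]_n) : bil M u v = \sum_j \sum_i u i 0 * M i j * v j 0.
  rewrite /bil mxE; apply: eq_bigr => j _; rewrite mxE mulr_suml.
  by apply: eq_bigr => i _; rewrite mxE.
have -> : 2 * bil M (y s) (dy s) = bil M (y s) (dy s) + bil M (dy s) (y s).
  by rewrite (bilC (dy s) _ sM); ring.
rewrite (_ : (fun t => _) =
    \sum_j \sum_i (fun t => y t i 0 * M i j * y t j 0)); last first.
  apply/funext => t; rewrite quadE bilE fct_sumE.
  by apply: eq_bigr => j _; rewrite fct_sumE.
rewrite !bilE -big_split /=; apply: is_derive_sum => j.
rewrite -big_split /=; apply: is_derive_sum => i.
have h1 := @is_deriveM _ _ (fun t => y t i 0) (cst (M i j)) s 1 _ _ (yd i) (is_derive_cst _ _ _).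
have := @is_deriveM _ _ _ (fun t => y t j 0) s 1 _ _ h1 (yd j).
move=> /is_derive_eq; apply.
by rewrite /GRing.scale /= mulrfctE /=; ring.
Qed.

Lemma dilation_bounded n (G : 'M[R]_n) S :
  exists2 C, 0 < C & forall s, `|s| <= S -> `|dilation G s| <= C.
Proof.
have [|C C0 dC] := @finite_bound ('I_n * 'I_n)%type R (fun s => `|s| <= S)
    (fun ij s => `|dilation G s ij.1 ij.2|).
  move=> -[i j] /=; apply: continuous_bounded.
  exact: (is_derive_continuous (fun s => dilation_derive G s i j)).
exists C => // s sS; apply: mx_norm_le => [|i j]; first exact: ltW.
exact: (dC (i, j)).
Qed.

Lemma dilation_lipschitz n (G : 'M[R]_n) S :
  exists2 L, 0 < L & forall s t, `|s| <= S -> `|t| <= S ->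
    `|dilation G s - dilation G t| <= L * `|s - t|.
Proof.
have [C C0 dC] := dilation_bounded G S.
have L0 : 0 <= n%:R * `|G| * C by rewrite !mulr_ge0 // ltW.
exists (n%:R * `|G| * C + 1); first by rewrite ltr_wpDl.
move=> s t sS tS; apply: (@le_trans _ _ ((n%:R * `|G| * C) * `|s - t|)).
  apply: mx_norm_le => [|i j]; first by rewrite mulr_ge0.
  rewrite !mxE; apply: (is_derive_lipschitz (fun s => dilation_derive G s i j)) sS tS.
  move=> x xS; rewrite (le_trans (le_mx_norm _ _ _)) //.
  by rewrite (le_trans (mx_norm_mulmx _ _)) // ler_wpM2l ?mulr_ge0 // dC.
by rewrite ler_wpM2r // lerDl.
Qed.

End RealFunctions.

(** * The time at which an exponentially decaying function crosses the level 1 *)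

Section Decay.
Context {R : realType} (c : R) (f : R -> R).
Hypothesis c0 : 0 < c.
Hypothesis dec : forall a b, a <= b -> expR (c * b) * f b <= expR (c * a) * f a.

Lemma decay_eq1 : continuous f -> 0 < f 0 -> exists s, f s = 1.
Proof.
move=> cf f0; have f1 : 0 < (f 0)^-1 by rewrite invr_gt0.
(* This makes [exp(c t) >= c t] at least both [f 0] and its inverse, so that
   [f t <= 1 <= f (- t)]. *)
pose t := (f 0 + (f 0)^-1) / c.
have t0 : 0 < t by rewrite divr_gt0 // addr_gt0.
have ct : c * t = f 0 + (f 0)^-1 by rewrite mulrC divfK // gt_eqF.
have et : c * t <= expR (c * t) by have := expR_ge1Dx (c * t); lra.
have et0 := expR_gt0 (c * t).
have ft : f t <= 1.
  have := dec (ltW t0); rewrite mulr0 expR0 mul1r => h.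
  by rewrite -(ler_pM2l et0) mulr1; lra.
have fNt : 1 <= f (- t).
  have Nt0 : - t <= 0 by lra.
  have := dec Nt0; rewrite mulr0 expR0 mul1r mulrN expRN => h.
  rewrite mulrC ler_pdivlMr // in h; apply: le_trans h.
  by rewrite -ler_pdivrMl // mulr1; lra.
have [||s _ ps] := @IVT R f (- t) t 1 _ (continuous_subspaceT cf).
- lra.
- by rewrite ge_min le_max ft fNt orbT.
- by exists s.
Qed.

Lemma decay_le1 s : f s = 1 -> (s <= 0) = (f 0 <= 1).
Proof.
move=> fs; apply/idP/idP => [s0|f0].
  have := dec s0; rewrite fs mulr1 mulr0 expR0 mul1r => /le_trans; apply.
  by rewrite expR_le1 pmulr_rle0.
rewrite leNgt; apply/negP => s0; have := dec (ltW s0).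
rewrite fs mulr1 mulr0 expR0 mul1r; have := @expR_gt1 _ (c * s).
rewrite mulr_gt0 //; lra.
Qed.

Lemma decay_uniq s : f s = 1 -> f 0 = 1 -> s = 0.
Proof.
move=> fs f0; have s0 : s <= 0 by rewrite (decay_le1 fs) f0.
apply/eqP; rewrite eq_le s0 /=; have := dec s0.
by rewrite fs f0 !mulr1 ler_expR ler_pM2l.
Qed.

(** For [s > 0], decay gives [1 + c s <= exp(c s) <= 4]; for [s <= 0] it gives
    [exp(c s) >= 1/4 > exp(-4)]. *)
Lemma decay_time_bound s : f s = 1 -> 4^-1 <= f 0 <= 4 -> `|s| <= 4 / c.
Proof.
move=> fs /andP[q1 q2].
rewrite ler_norml -mulNr ler_pdivrMr // ler_pdivlMr // ![s * c]mulrC.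
have [s0|s0] := leP s 0.
  have cs0 : c * s <= 0 by rewrite pmulr_rle0.
  apply/andP; split; last lra.
  have := dec s0; rewrite fs mulr1 mulr0 expR0 mul1r => h.
  have e4 : 4 < expR 4 :> R by have := @expR_ge1Dx R 4; lra.
  rewrite -ler_expR expRN; apply: le_trans (le_trans q1 h).
  by rewrite lef_pV2 ?posrE ?expR_gt0 // ltW.
have cs0 : 0 < c * s by rewrite mulr_gt0.
apply/andP; split; first lra.
have := dec (ltW s0); rewrite fs mulr1 mulr0 expR0 mul1r => h.
have := expR_ge1Dx (c * s); lra.
Qed.

(** An excess over the level 1 at time [t] controls how far ahead the crossing lies. This is what
    makes the crossing time Lipschitz in the initial point. *)
Lemma decay_time_diff s t : f s = 1 -> t <= s -> c * (s - t) <= f t - 1.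
Proof.
move=> fs ts; have := dec ts; rewrite fs mulr1 => h.
have : expR (c * (s - t)) <= f t.
  by rewrite mulrBr expRD expRN ler_pdivrMr ?expR_gt0 // [leRHS]mulrC.
have := expR_ge1Dx (c * (s - t)); lra.
Qed.

End Decay.

(** * The homogeneous norm, its unit ball and the regularity of its logarithm *)

(** For nonzero [x] this is the logarithm of the homogeneous norm, the number through which the
    feedback depends on that norm. *)
Definition hlog (R : realType) n (d : R -> 'M[R]_n) (P : 'M[R]_n) (x : 'cV[R]_n) : R :=
  xget 0 [set s : R | wnorm P (d (- s) *m x) = 1].

Section HomogeneousNorm.
Context {R : realType} (n : nat).
Variables G P : 'M[R]_n.
Hypotheses (Ppd : posdef P) (PGpd : posdef (P *m G + G^T *m P)).
Implicit Types x y : 'cV[R]_n.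

Let phi x s := quad P (dilation G (- s) *m x).

Lemma hnormE x : x != 0 -> hnorm (dilation G) P x = expR (hlog (dilation G) P x).
Proof. by rewrite /hnorm => /negbTE ->. Qed.

Lemma quad_dilation_derive x (s : R) : is_derive s (1 : R) (phi x)
  (- quad (P *m G + G^T *m P) (dilation G (- s) *m x)).
Proof.
set y := fun t => dilation G (- t) *m x.
have -> : - quad (P *m G + G^T *m P) (y s) = 2 * bil P (y s) (- (G *m y s)).
  have eT : bil (G^T *m P) (y s) (y s) = bil (P *m G) (y s) (y s).
    by rewrite bil_tr trmx_mul trmxK Ppd.1.
  by rewrite quadE bil_mxD bilNr bil_mulmxr eT; ring.
apply: (@derive_quad _ _ P y (fun t => - (G *m y t))); first exact: Ppd.1.
move=> i; rewrite /y mulmxA -mulNmx.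
apply: (@derive_mulmxr _ _ _ _ (fun t => dilation G (- t))
  (fun t => - (G *m dilation G (- t)))).
move=> k l; have h := dilation_derive G (- s) k l.
have hN : is_derive s (1 : R) -%R (-1) by exact: is_deriveN.
have := @is_derive1_comp _ (fun t => dilation G t k l) -%R s _ _ h hN.
by move=> /is_derive_eq; apply; rewrite mulrN1 [RHS]mxE.
Qed.

(** Since [P <= C (P G + G^T P)] as forms, [phi' <= - phi / C]; the rate is [1 / C], uniformly in
    [x]. *)
Lemma quad_dilation_decay : exists2 c, 0 < c & forall x a b, a <= b ->
  expR (c * b) * phi x b <= expR (c * a) * phi x a.
Proof.
have [C C0 PC] := quad_le_posdef P PGpd.
exists C^-1 => [|x a b ab]; first by rewrite invr_gt0.
pose f s := expR (C^-1 * s) * phi x s.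
pose df s := expR (C^-1 * s) * (C^-1 * phi x s -
  quad (P *m G + G^T *m P) (dilation G (- s) *m x)).
apply: (@is_derive_nonincreasing _ f df _ _ _ _ ab) => s.
  have he : is_derive s (1 : R) (fun t => expR (C^-1 * t)) (expR (C^-1 * s) * C^-1).
    apply: (@is_derive1_comp _ expR (fun t => C^-1 * t)).
    have := @is_deriveZ _ _ _ id C^-1 s 1 _ (is_derive_id _ _).
    by move=> /is_derive_eq; apply; rewrite /GRing.scale /= mulr1.
  have := @is_deriveM _ _ _ _ s 1 _ _ he (quad_dilation_derive x s).
  by move=> /is_derive_eq; apply; rewrite /df /GRing.scale /=; ring.
rewrite /df pmulr_rle0 ?expR_gt0 // subr_le0 mulrC ler_pdivrMr //.
by rewrite (le_trans (ler_norm _)) // mulrC PC.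
Qed.

Lemma phi0 x : phi x 0 = quad P x.
Proof. by rewrite /phi oppr0 dilation0 mul1mx. Qed.

(** Decay and continuity ensure that the level 1 is attained, so [xget] does not return its default
    value. *)
Lemma phi_hlog x : x != 0 -> phi x (hlog (dilation G) P x) = 1.
Proof.
move=> x0; have [c c0 dec] := quad_dilation_decay.
have wn s : (wnorm P (dilation G (- s) *m x) = 1) <-> (phi x s = 1).
  rewrite /wnorm -/(phi x s); split => [h|->]; last exact: sqrtr1.
  by rewrite -[LHS]sqr_sqrtr ?h ?expr1n //; exact: quad_ge0.
have [||s /wn ps] := decay_eq1 c0 (dec x).
- exact: (is_derive_continuous (quad_dilation_derive x)).
- by rewrite phi0; exact: Ppd.2.
- apply/wn; rewrite /hlog.
  exact: (@xgetPex _ 0 [set s | wnorm P (dilation G (- s) *m x) = 1]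
    (ex_intro _ s ps)).
Qed.

Lemma hlog_sphere x : quad P x = 1 -> hlog (dilation G) P x = 0.
Proof.
move=> qx; have [c c0 dec] := quad_dilation_decay.
have x0 : x != 0.
  by apply/eqP => x0; move: qx; rewrite x0 quad0 => /esym/eqP; rewrite oner_eq0.
by apply: (decay_uniq c0 (dec x)); [exact: phi_hlog | rewrite phi0].
Qed.

(** A decaying [phi] crosses the level 1 at a nonpositive time exactly when its value at time 0 is
    at most 1. *)
Lemma hellipsoidE x : hellipsoid (dilation G) P x <-> quad P x <= 1.
Proof.
rewrite /hellipsoid /=; have [->|x0] := eqVneq x 0.
  by rewrite /hnorm eqxx quad0; split.
have [c c0 dec] := quad_dilation_decay.
by rewrite hnormE // expR_le1 (decay_le1 c0 (dec x) (phi_hlog x0)) phi0.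
Qed.

(** In the norm of [P] the radii run from 1/2 to 2: a neighbourhood of the unit sphere away from the
    origin. *)
Let annulus x := 4^-1 <= quad P x <= 4.

Lemma annulus_neq0 x : annulus x -> x != 0.
Proof. by move=> /andP[q _]; apply/eqP => x0; move: q; rewrite x0 quad0; lra. Qed.

Lemma annulus_bounded : exists2 C, 0 < C & forall x, annulus x -> `|x| <= C.
Proof.
have [C C0 PC] := posdef_coercive Ppd; exists (4 * C + 1) => [|x /andP[_ q]]; first lra.
have C1 : 0 <= 4 * C + 1 by lra.
rewrite -(ler_pXn2r (ltn0Sn 1)) ?nnegrE //.
have : C * quad P x <= C * 4 by rewrite ler_pM2l.
have := PC x; have : 0 <= (4 * C) ^+ 2 by exact: sqr_ge0.
rewrite [X in _ -> _ -> _ -> _ <= X]sqrrD expr1n; lra.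
Qed.

Lemma hlog_bounded :
  exists2 S, 0 < S & forall x, annulus x -> `|hlog (dilation G) P x| <= S.
Proof.
have [c c0 dec] := quad_dilation_decay; exists (4 / c); first exact: divr_gt0.
move=> x ax; apply: (decay_time_bound c0 (dec x)); last by rewrite phi0.
exact/phi_hlog/annulus_neq0.
Qed.

(** Let [s >= t] be the crossing times of [x] and [y]. Then [c (s - t) <= phi x t - 1 = phi x t -
    phi y t], a difference of squares that factors through [x + y] and [x - y], both moved by the
    bounded matrix [dilation G (- t)]. *)
Lemma hlog_lipschitz : exists2 L, 0 < L & forall x y, annulus x -> annulus y ->
  `|hlog (dilation G) P x - hlog (dilation G) P y| <= L * `|x - y|.
Proof.
have [c c0 dec] := quad_dilation_decay.
have [S S0 hS] := hlog_bounded.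
have [D D0 dD] := dilation_bounded G S.
have [Y Y0 aY] := annulus_bounded.
have [b b0 bP] := bil_le P.
pose nD := n%:R * D.
have nD0 : 0 <= nD by rewrite mulr_ge0 // ltW.
pose L := (2 * b * nD ^+ 2 * Y + 1) / c.
have L0 : 0 < L.
  by rewrite divr_gt0 // ltr_wpDl // !mulr_ge0 ?sqr_ge0 // ltW.
exists L => // x y; wlog st : x y / hlog (dilation G) P y <= hlog (dilation G) P x.
  move=> wl ax ay.
  have [st|/ltW st] := leP (hlog (dilation G) P y) (hlog (dilation G) P x).
    exact: wl.
  by rewrite distrC (distrC x); exact: wl.
move=> ax ay.
have tS := hS y ay.
have ps := phi_hlog (annulus_neq0 ax); have pt := phi_hlog (annulus_neq0 ay).
move: (hlog _ _ x) (hlog _ _ y) ps pt tS st => s t ps pt tS st.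
rewrite ger0_norm ?subr_ge0 // /L mulrAC ler_pdivlMr // mulrC.
apply: le_trans (decay_time_diff (dec x) ps st) _.
have nt : `|dilation G (- t)| <= D by rewrite dD // normrN.
have dn (z : 'cV[R]_n) : `|dilation G (- t) *m z| <= nD * `|z|.
  rewrite (le_trans (mx_norm_mulmx _ _)) // ler_wpM2r //.
  by rewrite ler_wpM2l.
have -> : phi x t - 1 =
    bil P (dilation G (- t) *m (y + x)) (dilation G (- t) *m (x - y)).
  rewrite -pt /phi !quadE !mulmxDr mulmxN !(bilDl, bilDr, bilNl, bilNr).
  by rewrite (bilC (_ *m x) _ Ppd.1); ring.
have yx : `|y + x| <= 2 * Y.
  rewrite (le_trans (ler_normD _ _)) // mulr_natl mulr2n lerD //; exact: aY.
have e1 : `|dilation G (- t) *m (y + x)| <= nD * (2 * Y).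
  by rewrite (le_trans (dn _)) // ler_wpM2l.
have e2 := ler_pM (normr_ge0 _) (normr_ge0 _) e1 (dn (x - y)).
rewrite (le_trans (ler_norm _)) // (le_trans (bP _ _)) // -mulrA.
apply: le_trans (ler_wpM2l (ltW b0) e2) _.
rewrite [leRHS]mulrDl mul1r (_ : b * _ = 2 * b * nD ^+ 2 * Y * `|x - y|); last by ring.
by rewrite lerDl.
Qed.

End HomogeneousNorm.

(** * Integral inequalities under almost everywhere bounds *)

Section RealIntegral.
Context d (T : measurableType d) (R : realType) (mu : {measure set T -> \bar R}).

(** Almost everywhere on [D], [h] equals its positive part. *)
Lemma Rintegral_ae_ge0 (D : set T) (h : T -> R) :
  measurable D -> mu.-integrable D (EFin \o h) ->
  {ae mu, forall t, D t -> 0 <= h t} -> 0 <= \int[mu]_(t in D) h t.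
Proof.
move=> mD ih h0; rewrite /Rintegral fine_ge0 //.
rewrite (@ae_eq_integral _ _ _ mu D (EFin \o h)^\+%E) //.
- by apply: integral_ge0 => x _; exact: funepos_ge0.
- exact: (measurable_int mu ih).
- exact: (measurable_int mu (integrable_funepos mD ih)).
- apply: filterS h0 => t ht Dt; rewrite funeposE.
  by rewrite max_l //= lee_fin ht.
Qed.

Lemma Rintegral_lincomb (D : set T) (n : nat) (c : 'I_n -> R) (f : 'I_n -> T -> R) :
  measurable D -> (forall i, mu.-integrable D (EFin \o f i)) ->
  mu.-integrable D (EFin \o (fun t => \sum_i c i * f i t)) /\
  \int[mu]_(t in D) (\sum_i c i * f i t) = \sum_i c i * \int[mu]_(t in D) f i t.
Proof.
move=> mD fi; elim: (index_enum _) => [|i s [iS eS]].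
  split; last by under eq_Rintegral do rewrite big_nil; rewrite big_nil Rintegral_cst // mul0r.
  rewrite (_ : _ \o _ = cst 0%E); first exact: integrable0.
  by apply/funext => t /=; rewrite big_nil.
have ifi : mu.-integrable D (EFin \o (fun t => c i * f i t)).
  by apply: eq_integrable (integrableZl _ (c i) (fi i)).
split.
  rewrite (_ : _ \o _ = (fun t => (c i * f i t)%:E +
    (\sum_(j <- s) c j * f j t)%:E)%E); first exact: (integrableD mD ifi iS).
  by apply/funext => t /=; rewrite big_cons EFinD.
under eq_Rintegral do rewrite big_cons.
by rewrite RintegralD // RintegralZl // eS big_cons.
Qed.

End RealIntegral.

Section LebesgueIntegral.
Context {R : realType}.
Local Notation mu := (@lebesgue_measure R).

Lemma lebesgue_aeS (P Q : R -> Prop) : (forall t, P t -> Q t) ->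
  {ae mu, forall t, P t} -> {ae mu, forall t, Q t}.
Proof.
by move=> PQ; apply: filterS PQ; exact: (ae_filter_ringOfSetsType mu).
Qed.

Lemma integrable_cst_itv (a b : R) (K : R) (x y : bool) :
  mu.-integrable [set` Interval (BSide x a) (BSide y b)] (EFin \o cst K).
Proof.
have cK : {within `[a, b], continuous (cst K : R -> R)}.
  by apply: continuous_subspaceT => z; exact: cvg_cst.
have iK := continuous_compact_integrable (@segment_compact R a b) cK.
apply: integrableS iK => //.
by apply: subset_itv; case: x; case: y; rewrite bnd_simp.
Qed.

Lemma Rintegral_itv_oc_cst (a b K : R) : a <= b ->
  \int[mu]_(t in `]a, b]) K = K * (b - a).
Proof.
move=> ab; rewrite Rintegral_cst //= lebesgue_measure_itv /= lte_fin.
by have [->|ab'] := eqVneq a b; rewrite ?ltxx ?subrr // lt_neqAle ab' ab.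
Qed.

Lemma Rintegral_ae_le (a b K : R) (g : R -> R) : a <= b ->
  mu.-integrable `]a, b] (EFin \o g) ->
  {ae mu, forall t, a < t <= b -> g t <= K} ->
  \int[mu]_(t in `]a, b]) g t <= K * (b - a).
Proof.
move=> ab ig gK; rewrite -Rintegral_itv_oc_cst // -subr_ge0.
have iK : mu.-integrable `]a, b] (EFin \o cst K) by exact: integrable_cst_itv.
rewrite -(RintegralB _ iK ig) //; apply: Rintegral_ae_ge0 => //.
  have := integrableB _ iK ig; apply => //.
by apply: lebesgue_aeS gK => t h; rewrite /= in_itv /= subr_ge0 => /h.
Qed.

Lemma Rintegral_ae_norm_le (a b K : R) (g : R -> R) : a <= b ->
  mu.-integrable `]a, b] (EFin \o g) ->
  {ae mu, forall t, a < t <= b -> `|g t| <= K} ->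
  `|\int[mu]_(t in `]a, b]) g t| <= K * (b - a).
Proof.
move=> ab ig gK; rewrite ler_norml; apply/andP; split.
  have iN : mu.-integrable `]a, b] (EFin \o (fun t => -1 * g t)).
    by apply: eq_integrable (integrableZl _ (-1) ig).
  have := Rintegral_ae_le ab iN; rewrite RintegralZl // mulN1r => h.
  rewrite lerNl; apply: h; apply: lebesgue_aeS gK => t h /h.
  by rewrite mulN1r => /(le_trans _); apply; rewrite -normrN ler_norm.
apply: Rintegral_ae_le => //; apply: lebesgue_aeS gK => t h /h.
exact/le_trans/ler_norm.
Qed.

(** This is the passage to the limit for all the dyadic error terms below. *)
Lemma le_half_pow (x y K : R) : (forall k, x <= y + K / 2 ^+ k) -> x <= y.
Proof.
move=> h; rewrite leNgt; apply/negP => yx.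
have xy : 0 < x - y by rewrite subr_gt0.
have K0 : 0 < K by have := h 0%N; rewrite expr0 divr1; lra.
pose k := (Num.truncn (K / (x - y))).+1.
have kK : K / (x - y) < k%:R by rewrite truncnS_gt.
have k2 : k%:R <= 2 ^+ k :> R by rewrite -natrX ler_nat ltnW // ltn_expl.
have := h k; rewrite -lerBlDl ler_pdivlMr ?exprn_gt0 // => h'.
have : K < (x - y) * k%:R by rewrite mulrC -ltr_pdivrMr.
have : (x - y) * k%:R <= (x - y) * 2 ^+ k by rewrite ler_pM2l.
lra.
Qed.

End LebesgueIntegral.

(** * Primitives of continuous functions and geometric limits *)

Section PrimitiveIntegral.
Context {R : realType}.
Local Notation mu := (@lebesgue_measure R).

Lemma lipschitz_continuous (f : R -> R) K :
  (forall s t, `|f s - f t| <= K * `|s - t|) -> continuous f.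
Proof.
move=> fK x; apply/cvgrPdist_le => e e0.
have K1 : 0 < `|K| + 1 by rewrite ltr_wpDl.
near=> y; rewrite (le_trans (fK x y)) //.
have : `|x - y| <= e / (`|K| + 1).
  near: y; apply/nbhs_ballP; exists (e / (`|K| + 1)) => [|z /ltW //].
  exact: divr_gt0.
rewrite ler_pdivlMr // => /(le_trans _); apply.
by rewrite mulrC ler_wpM2l // (le_trans (ler_norm K)) // lerDl.
Unshelve. all: end_near.
Qed.

Lemma continuous_integrable_itv (f : R -> R) a b : continuous f ->
  mu.-integrable `[a, b] (EFin \o f).
Proof.
move=> cf; apply: continuous_compact_integrable; first exact: segment_compact.
exact: continuous_subspaceT.
Qed.

Lemma Rintegral_itv_diff (f : R -> R) a b : 0 <= a -> a <= b ->
  mu.-integrable `[0, b] (EFin \o f) ->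
  \int[mu]_(s in `[0, b]) f s - \int[mu]_(s in `[0, a]) f s =
  \int[mu]_(s in `]a, b]) f s.
Proof. by move=> a0 ab ifb; rewrite Rintegral_itvB ?bnd_simp. Qed.

Lemma primitive_lipschitz (f : R -> R) C : continuous f ->
  (forall s, `|f s| <= C) -> forall a b,
  `|\int[mu]_(s in `[0, a]) f s - \int[mu]_(s in `[0, b]) f s| <= C * `|a - b|.
Proof.
move=> cf fC; have C0 : 0 <= C := le_trans (normr_ge0 _) (fC 0).
(* At negative times the interval is empty and the primitive vanishes, so the estimate holds on the
   whole line. *)
have neg t : t < 0 -> \int[mu]_(s in `[0, t]) f s = 0.
  by move=> t0; rewrite set_itv_ge ?Rintegral_set0 // bnd_simp -ltNge.
have oc a b : 0 <= a -> a <= b ->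
    `|\int[mu]_(s in `[0, b]) f s - \int[mu]_(s in `[0, a]) f s| <= C * (b - a).
  move=> a0 ab; rewrite Rintegral_itv_diff //; last exact: continuous_integrable_itv.
  apply: Rintegral_ae_norm_le => //; last exact: aeW.
  apply: integrableS (continuous_integrable_itv a b cf) => //.
  by apply: subset_itvr; rewrite bnd_simp.
have z0 : \int[mu]_(s in `[0, 0]) f s = 0 by rewrite set_itv1 Rintegral_set1.
have wl a b : a <= b ->
  `|\int[mu]_(s in `[0, b]) f s - \int[mu]_(s in `[0, a]) f s| <= C * (b - a).
  move=> ab; have [a0|a0] := leP 0 a; first exact: oc.
  rewrite (neg a a0); have [b0|b0] := leP 0 b; last first.
    by rewrite (neg b b0) subrr normr0 mulr_ge0 // subr_ge0.
  have := oc 0 b (lexx _) b0; rewrite z0 => /le_trans; apply.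
  by rewrite ler_wpM2l // lerB // ltW.
move=> a b; have [ab|/ltW ab] := leP a b.
  by rewrite distrC (distrC a) (ger0_norm (_ : 0 <= b - a)) ?subr_ge0 // wl.
by rewrite (ger0_norm (_ : 0 <= a - b)) ?subr_ge0 // wl.
Qed.

Lemma primitive_dist (f g : R -> R) K T t : continuous f -> continuous g ->
  0 <= K -> 0 <= T -> t <= T -> (forall s, 0 <= s -> s <= t -> `|f s - g s| <= K) ->
  `|\int[mu]_(s in `[0, t]) f s - \int[mu]_(s in `[0, t]) g s| <= K * T.
Proof.
move=> cf cg K0 T0 tT fgK; have [t0|t0] := leP 0 t; last first.
  rewrite set_itv_ge ?bnd_simp -?ltNge // !Rintegral_set0 subrr normr0.
  exact: mulr_ge0.
have iff := continuous_integrable_itv 0 t cf.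
have ig := continuous_integrable_itv 0 t cg.
rewrite -RintegralB // -Rintegral_itv_obnd_cbnd; last first.
  apply: integrableS (integrableB _ iff ig) => //.
  by apply: subset_itvr; rewrite bnd_simp.
apply: le_trans (_ : K * (t - 0) <= _); last first.
  by rewrite subr0 ler_wpM2l.
apply: Rintegral_ae_norm_le => //.
  apply: integrableS (integrableB _ iff ig) => //.
  by apply: subset_itvr; rewrite bnd_simp.
by apply: aeW => s /andP[s0 st]; exact: fgK (ltW s0) st.
Qed.

(* The intervals [[u k - 2 a / 2^k, u k + 2 a / 2^k]] are nested. *)
Lemma geometric_limit (u : nat -> R) a : 0 <= a ->
  (forall k, `|u k.+1 - u k| <= a / 2 ^+ k) ->
  exists l, forall k, `|l - u k| <= 2 * a / 2 ^+ k.
Proof.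
move=> a0 ua.
have e0 k : 0 <= a / 2 ^+ k :> R by rewrite divr_ge0 // exprn_ge0.
have eS k : a / 2 ^+ k.+1 = a / 2 ^+ k / 2 :> R by rewrite exprSr invfM mulrA.
pose lo k := u k - 2 * (a / 2 ^+ k); pose hi k := u k + 2 * (a / 2 ^+ k).
have loS k : lo k <= lo k.+1.
  by rewrite /lo eS; have := ua k; rewrite ler_norml => /andP[]; lra.
have hiS k : hi k.+1 <= hi k.
  by rewrite /hi eS; have := ua k; rewrite ler_norml => /andP[]; lra.
have lo_mono : {homo lo : i j / (i <= j)%N >-> i <= j}.
  exact: homo_leq (@lexx _ _) (@le_trans _ _) loS.
have hi_mono : {homo hi : i j / (i <= j)%N >-> j <= i}.
  apply: (homo_leq (@lexx _ _) (fun _ _ _ h1 h2 => le_trans h2 h1)) hiS.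
have lohi i j : lo i <= hi j.
  have h1 := lo_mono _ _ (leq_maxl i j); have h2 := hi_mono _ _ (leq_maxr i j).
  have : lo (maxn i j) <= hi (maxn i j) by rewrite /lo /hi; have := e0 (maxn i j); lra.
  lra.
pose S := range lo.
have S0 : S !=set0 by exists (lo 0%N); exists 0%N.
have ubS k : ubound S (hi k) by move=> _ [i _ <-]; exact: lohi.
exists (sup S) => k; rewrite ler_distl -mulrA; apply/andP; split.
  by apply: ub_le_sup; [exists (hi 0%N); exact: ubS | exists k].
by apply: ge_sup => //; exact: ubS.
Qed.

End PrimitiveIntegral.

(** * Local existence by Picard iteration *)

Section Picard.
Context {R : realType} (n : nat).
Local Notation mu := (@lebesgue_measure R).
Variables (F : 'cV[R]_n -> 'cV[R]_n) (L C : R) (x0 : 'cV[R]_n).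
Hypotheses (L0 : 0 < L) (FL : forall x y, `|F x - F y| <= L * `|x - y|).
Hypothesis FC : forall x, `|F x| <= C.
Implicit Types (x : R -> 'cV[R]_n).

Let C_ge0 : 0 <= C. Proof. by have := FC 0; apply: le_trans. Qed.

Let C_lipschitz x := forall s t, `|x s - x t| <= C * `|s - t|.

Lemma field_continuous x i : C_lipschitz x -> continuous (fun s => F (x s) i 0).
Proof.
move=> xC; apply: (@lipschitz_continuous _ _ (L * C)) => s t.
have := le_mx_norm (F (x s) - F (x t)) i 0; rewrite !mxE => /le_trans; apply.
by rewrite (le_trans (FL _ _)) // -mulrA ler_wpM2l // ltW.
Qed.

(** For [t < 0] the integral is over the empty set and the value is [x0], so the curves are defined,
    and [C]-Lipschitz, on the whole line. *)
Definition picard_map x (t : R) : 'cV[R]_n :=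
  \col_i (x0 i 0 + \int[mu]_(s in `[0, t]) F (x s) i 0).

Lemma picard_map_lipschitz x : C_lipschitz x -> C_lipschitz (picard_map x).
Proof.
move=> xC s t; apply: mx_norm_le => [|i j]; first exact: mulr_ge0.
rewrite (ord1 j) !mxE opprD addrACA subrr add0r.
apply: primitive_lipschitz; first exact: field_continuous.
by move=> u; rewrite (le_trans (le_mx_norm _ _ _)).
Qed.

Lemma picard_map_dist x y K T t : C_lipschitz x -> C_lipschitz y ->
  0 <= K -> 0 <= T -> t <= T -> (forall s, s <= T -> `|x s - y s| <= K) ->
  `|picard_map x t - picard_map y t| <= L * K * T.
Proof.
move=> xC yC K0 T0 tT xyK; have LK0 : 0 <= L * K by rewrite mulr_ge0 // ltW.
apply: mx_norm_le => [|i j]; first exact: mulr_ge0.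
rewrite (ord1 j) !mxE opprD addrACA subrr add0r.
apply: primitive_dist => //; [exact: field_continuous..|].
move=> s _ st; have := le_mx_norm (F (x s) - F (y s)) i 0.
rewrite !mxE => /le_trans; apply.
rewrite (le_trans (FL _ _)) // (ler_wpM2l (ltW L0)) //.
by rewrite xyK // (le_trans st).
Qed.

Definition picard_iter k := iter k picard_map (fun=> x0).

Lemma picard_iter_lipschitz k : C_lipschitz (picard_iter k).
Proof.
elim: k => [s t|k IH]; first by rewrite /= subrr normr0 mulr_ge0.
exact: picard_map_lipschitz.
Qed.

(** Up to this time the Picard map contracts by the factor [L T = 1/2]. *)
Let T := (2 * L)^-1.

Let T_gt0 : 0 < T. Proof. by rewrite invr_gt0 mulr_gt0. Qed.

Let LT : L * T = 2^-1.
Proof. by rewrite /T invfM mulrCA mulfV ?mulr1 // gt_eqF. Qed.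

Lemma picard_iter_dist k t : t <= T ->
  `|picard_iter k.+1 t - picard_iter k t| <= C * T / 2 ^+ k.
Proof.
have T0 := ltW T_gt0.
elim: k t => [|k IH] t tT.
  rewrite expr0 divr1; apply: mx_norm_le => [|i j]; first exact: mulr_ge0.
  rewrite (ord1 j) !mxE addrC addKr.
  have c0 : continuous (cst 0 : R -> R) by move=> ?; exact: cvg_cst.
  rewrite -[X in `|X|]subr0 -[X in _ - X](_ : \int[mu]_(s in `[0, t]) (cst 0 s) = 0).
    have cF : continuous (fun _ : R => F x0 i 0) by move=> ?; exact: cvg_cst.
    apply: (primitive_dist cF c0) => // s _ _.
    by rewrite subr0 (le_trans (le_mx_norm _ _ _)).
  by rewrite Rintegral_cst // mul0r.
have K0 : 0 <= C * T / 2 ^+ k by rewrite divr_ge0 ?mulr_ge0 // exprn_ge0.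
have := picard_map_dist (@picard_iter_lipschitz k.+1) (@picard_iter_lipschitz k)
  K0 T0 tT IH.
move=> /le_trans; apply; rewrite mulrAC LT.
by rewrite le_eqVlt exprS invfM; apply/orP; left; apply/eqP; ring.
Qed.

Theorem picard : exists T' x, [/\ 0 < T', C_lipschitz x, x 0 = x0 &
  forall t i, t < T' ->
    x t i 0 = x 0 i 0 + \int[mu]_(s in `[0, t]) F (x s) i 0].
Proof.
have T0 := ltW T_gt0; have CT0 : 0 <= C * T by rewrite mulr_ge0.
(* Freezing time at [T] gives a limit curve on the whole line without losing the Lipschitz constant
   [C]. *)
have /boolp.choice[l lP] : forall ti : R * 'I_n, exists l, forall k,
    `|l - picard_iter k (Num.min ti.1 T) ti.2 0| <= 2 * (C * T) / 2 ^+ k.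
  move=> [t i]; apply: geometric_limit => // k /=.
  have mT : Num.min t T <= T by rewrite ge_min lexx orbT.
  apply: le_trans (picard_iter_dist k mT).
  have := le_mx_norm
    (picard_iter k.+1 (Num.min t T) - picard_iter k (Num.min t T)) i 0.
  by rewrite !mxE.
pose x t : 'cV[R]_n := \col_i l (t, i).
have xP k t : `|x t - picard_iter k (Num.min t T)| <= 2 * (C * T) / 2 ^+ k.
  apply: mx_norm_le => [|i j]; first by rewrite divr_ge0 ?mulr_ge0 // exprn_ge0.
  by rewrite (ord1 j) !mxE; exact: (lP (t, i)).
have xC : C_lipschitz x.
  (* Two approximation errors [2 C T / 2^k], one at [s] and one at [t], add up to this constant. *)
  move=> s t; apply: (@le_half_pow _ _ _ (4 * (C * T))) => k.
  have h1 := xP k s; have h2 := xP k t.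
  have h3 := @picard_iter_lipschitz k (Num.min s T) (Num.min t T).
  have h4 : `|Num.min s T - Num.min t T| <= `|s - t|.
    have [sT|sT] := leP s T; have [tT|tT] := leP t T => //.
    - by rewrite !ler0_norm; lra.
    - by rewrite !ger0_norm; lra.
    - by rewrite subrr normr0.
  have h5 := ler_wpM2l C_ge0 h4.
  rewrite distrC in h2.
  have := ler_normD (x s - picard_iter k (Num.min s T))
    (picard_iter k (Num.min s T) - picard_iter k (Num.min t T)).
  have := ler_normD (x s - picard_iter k (Num.min t T))
    (picard_iter k (Num.min t T) - x t).
  rewrite !subrKA; lra.
have xE t i : t < T -> x t i 0 = x0 i 0 + \int[mu]_(s in `[0, t]) F (x s) i 0.
  move=> tT; have xt : x t = picard_map x t; last by rewrite {1}xt mxE.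
  apply/eqP; rewrite -subr_eq0 -normr_eq0 eq_le normr_ge0 andbT.
  (* Both [x t] and [picard_map x t] are within [C T / 2^k] of the iterate of index [k + 1]. *)
  apply: (@le_half_pow _ _ _ (2 * (C * T))) => k; rewrite add0r.
  have mt s : s <= T -> Num.min s T = s by move=> /min_idPl.
  have h1 := xP k.+1 t; rewrite (mt t (ltW tT)) in h1.
  have K0 : 0 <= 2 * (C * T) / 2 ^+ k by rewrite divr_ge0 ?mulr_ge0 // exprn_ge0.
  have := @picard_map_dist (picard_iter k) x _ T t (@picard_iter_lipschitz k) xC
    K0 T0 (ltW tT).
  have xk s : s <= T -> `|picard_iter k s - x s| <= 2 * (C * T) / 2 ^+ k.
    by move=> sT; have := xP k s; rewrite mt // distrC.
  move=> /(_ xk) h2.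
  have := ler_normD (x t - picard_iter k.+1 t) (picard_map (picard_iter k) t - picard_map x t).
  rewrite subrKA => /le_trans; apply.
  rewrite [leRHS](_ : _ = 2 * (C * T) / 2 ^+ k.+1 + L * (2 * (C * T) / 2 ^+ k) * T).
    exact: lerD.
  by rewrite (mulrAC L) LT exprS invfM; field.
have x00 : x 0 = x0.
  by apply/colP => i; rewrite xE // set_itv1 Rintegral_set1 addr0.
by exists T, x; split=> // t i tT; rewrite xE // x00.
Qed.

End Picard.

(** * Exit times and dyadic refinement of increments *)

Section Continuity.
Context {R : realType}.
Local Notation mu := (@lebesgue_measure R).

(** Both times are confined to the segment, since nothing is known of a solution at negative times
    or past its lifespan. *)
Definition continuous_on_seg (t1 : R) (phi : R -> R) := forall s e : R,
  0 <= s <= t1 -> 0 < e ->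
  exists2 d, 0 < d & forall t, 0 <= t <= t1 -> `|t - s| < d -> `|phi t - phi s| < e.

Lemma within_continuous_on_seg t1 (phi : R -> R) :
  {within `[0, t1], continuous phi} -> continuous_on_seg t1 phi.
Proof.
move=> /subspace_continuousP cphi s e st e0.
have s01 : `[0, t1]%classic s by rewrite /= in_itv.
have /cvgrPdist_lt/(_ e e0) := cphi s s01.
rewrite /= => /nbhs_ballP[d /= d0 h]; exists d => // t t01 ts.
rewrite distrC; apply: h; last by rewrite /= in_itv.
by rewrite /ball /= distrC.
Qed.

(** [t0] is the supremum of the times up to [t1] with [phi <= 0]. The end [t2] of the window is cut
    down to respect [t1], the length [h], and a continuity radius that ensures [phi <= 1]. *)
Lemma last_exit (phi : R -> R) t1 h : continuous_on_seg t1 phi -> 0 < h -> 0 <= t1 ->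
  phi 0 <= 0 -> 0 < phi t1 ->
  exists t0 t2, [/\ (0 <= t0) && (t2 <= t1), t0 < t2 <= t0 + h, phi t0 = 0, 0 < phi t2 &
    forall t, t0 <= t <= t2 -> 0 <= phi t <= 1].
Proof.
move=> cphi h0 t10 p0 p1.
pose S := [set t | 0 <= t <= t1 /\ phi t <= 0].
have S0 : S 0 by split=> //; rewrite lexx.
have hS : has_sup S by split; [exists 0 | exists t1 => t [/andP[]]].
pose t0 := sup S.
have t00 : 0 <= t0 by apply: ub_le_sup => //; case: hS.
have t0t1 : t0 <= t1 by apply: ge_sup; [exists 0 | move=> t [/andP[]]].
have t0in : 0 <= t0 <= t1 by rewrite t00.
have after t : t0 < t -> t <= t1 -> 0 < phi t.
  move=> tt tt1; have tin : 0 <= t <= t1 by rewrite (le_trans t00 (ltW tt)).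
  rewrite ltNge; apply/negP => pt; move: tt; rewrite ltNge => /negP; apply.
  by apply: ub_le_sup; [case: hS | split].
(* By continuity a positive value at [t0] would keep [S] away from its supremum; below, a negative
   one would carry [S] beyond it. *)
have pt0 : phi t0 <= 0.
  rewrite leNgt; apply/negP => pt0.
  have [d d0 dP] := cphi t0 _ t0in pt0.
  have [t [tin pt] tt] := sup_adherent d0 hS.
  have tt0 : t <= t0 by apply: ub_le_sup; [case: hS | split].
  have := dP t tin; rewrite ler0_norm ?subr_le0 // opprB ltrBlDl -ltrBlDr => /(_ tt).
  by rewrite ltr_norml => /andP[]; lra.
have t0lt : t0 < t1 by rewrite lt_neqAle t0t1 andbT; apply/eqP => t0E; move: pt0; rewrite t0E; lra.
have pt0' : phi t0 = 0.
  apply/eqP; rewrite eq_le pt0 leNgt; apply/negP => pt0'.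
  have e0 : 0 < - phi t0 by lra.
  have [d d0 dP] := cphi t0 _ t0in e0.
  pose t := Num.min t1 (t0 + d / 2).
  have tt0 : t0 < t by rewrite lt_min t0lt /=; lra.
  have tt1 : t <= t1 by rewrite ge_min lexx.
  have td : t <= t0 + d / 2 by rewrite ge_min lexx orbT.
  have tin : 0 <= t <= t1 by rewrite tt1 andbT; lra.
  have := dP t tin; rewrite gtr0_norm ?subr_gt0 // => /(_ _).
  have tdd : t - t0 < d by lra.
  by move=> /(_ tdd); rewrite ltr_norml; have := after t tt0 tt1; lra.
have [d d0 dP] := cphi t0 _ t0in ltr01.
pose t2 := Num.min (Num.min t1 (t0 + d / 2)) (t0 + h).
have t2h : t2 <= t0 + h by rewrite ge_min lexx orbT.
have t2d : t2 <= t0 + d / 2 by rewrite !ge_min lexx !orbT.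
have t2t1 : t2 <= t1 by rewrite !ge_min lexx.
have t0t2 : t0 < t2 by rewrite !lt_min t0lt /=; apply/andP; split; lra.
exists t0, t2; split => //; [by rewrite t00 | by rewrite t0t2 | exact: after |].
move=> t /andP[tt0 tt2].
have tt1 : t <= t1 by exact: le_trans t2t1.
have -> : 0 <= phi t.
  by move: tt0; rewrite le_eqVlt => /predU1P[<-|/after/(_ tt1)/ltW//]; rewrite pt0'.
have := dP t; rewrite ger0_norm ?subr_ge0 // tt1 andbT (le_trans t00 tt0) pt0' subr0.
move=> /(_ isT) dt; apply: le_trans (ler_norm _) _; apply/ltW/dt; lra.
Qed.

(* Bisecting the interval k times divides the quadratic term by 2^k. *)
Lemma drop_quadratic_term (phi : R -> R) t0 t2 K C :
  (forall a b, t0 <= a -> a <= b -> b <= t2 ->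
    phi b - phi a <= K * (b - a) + C * (b - a) ^+ 2) ->
  forall a b, t0 <= a -> a <= b -> b <= t2 -> phi b - phi a <= K * (b - a).
Proof.
move=> H a b ta ab bt; apply: (@le_half_pow _ _ _ (C * (b - a) ^+ 2)) => k.
elim: k a b ta ab bt => [|k IH] a b ta ab bt; first by rewrite expr0 divr1; exact: H.
pose c := (a + b) / 2.
have ac : a <= c by rewrite /c; lra.
have cb : c <= b by rewrite /c; lra.
have h1 := IH a c ta ac (le_trans cb bt).
have h2 := IH c b (le_trans ta ac) cb bt.
have e1 : c - a = (b - a) / 2 by rewrite /c; field.
have e2 : b - c = (b - a) / 2 by rewrite /c; field.
rewrite e1 in h1; rewrite e2 in h2.
have -> : C * (b - a) ^+ 2 / 2 ^+ k.+1 = 2 * (C * ((b - a) / 2) ^+ 2 / 2 ^+ k).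
  by rewrite [2 ^+ k.+1]exprS; field; rewrite expf_neq0 // pnatr_eq0.
lra.
Qed.

End Continuity.

(** * Sufficiency of the speed condition on the sphere *)

Section SphereInvariance.
Context {R : realType} (n p : nat).
Local Notation mu := (@lebesgue_measure R).
Variables (P : 'M[R]_n) (Q : 'M[R]_p) (D : 'M[R]_(n, p)).
Variables (g : 'cV[R]_n -> 'cV[R]_n) (K : R).
Hypotheses (Ppd : posdef P) (Qpd : posdef Q) (K0 : 0 < K).
Hypothesis gK : forall x y, 4^-1 <= quad P x <= 4 -> 4^-1 <= quad P y <= 4 ->
  `|g x - g y| <= K * `|x - y|.

Let f x w := g x + D *m w.
Let annulus x := 4^-1 <= quad P x <= 4.

Section Sufficiency.
Hypothesis inward : forall x w, quad P x = 1 -> quad Q w <= 1 -> bil P x (f x w) <= 0.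

(** Compare [x] with its radial projection [y = x / r] on the sphere, where the speed is
    nonpositive. By the Lipschitz bound the difference costs a multiple of [r - 1], hence of
    [r^2 - 1]. *)
Lemma outward_speed : exists2 C, 0 < C & forall x w, 1 <= quad P x <= 4 ->
  quad Q w <= 1 -> bil P x (f x w) <= C * (quad P x - 1).
Proof.
have [b b0 bP] := bil_le P; have [Y Y0 aY] := annulus_bounded Ppd.
exists (2 * (b * Y * (K * Y))); first by rewrite !mulr_gt0.
move=> x w /andP[q1 q4] qw; pose r := Num.sqrt (quad P x).
have q0 : 0 <= quad P x by lra.
have r2 : r ^+ 2 = quad P x by exact: sqr_sqrtr.
have r1 : 1 <= r by rewrite -sqrtr1 ler_sqrt.
have r_le2 : r <= 2.
  by rewrite -(ler_pXn2r (ltn0Sn 1)) ?nnegrE ?r2 //; [rewrite -natrX; lra | lra].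
have r0 : r != 0 by apply/eqP; lra.
pose y := r^-1 *: x.
have xE : x = r *: y by rewrite scalerA mulfV // scale1r.
have qy : quad P y = 1 by rewrite quadZ -r2 exprVn mulVf // expf_neq0.
have ax : annulus x by apply/andP; split; lra.
have ay : annulus y by rewrite /annulus qy; apply/andP; split; lra.
have fE : f x w = f y w + (g x - g y) by rewrite /f [RHS]addrAC subrKC.
have h1 := inward qy qw.
have xy : x - y = (r - 1) *: y by rewrite scalerBl scale1r -xE.
have h2 : `|g x - g y| <= K * ((r - 1) * Y).
  apply: le_trans (gK ax ay) _; rewrite xy normrZ ger0_norm ?subr_ge0 //.
  by rewrite ler_wpM2l ?(ltW K0) // ler_wpM2l ?subr_ge0 // aY.
have h3 : bil P y (g x - g y) <= b * Y * (K * ((r - 1) * Y)).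
  apply: le_trans (ler_norm _) (le_trans (bP _ _) _).
  apply: ler_pM => //; first by rewrite mulr_ge0 // ltW.
  by rewrite ler_wpM2l ?(ltW b0) // aY.
have Z0 : 0 < b * Y * (K * Y) by rewrite !mulr_gt0.
set Z := b * Y * (K * Y) in Z0 *.
have {}h3 : bil P y (g x - g y) <= Z * (r - 1).
  by apply: le_trans h3 _; rewrite le_eqVlt; apply/orP; left; apply/eqP; rewrite /Z; ring.
rewrite -r2 {1}xE bilZl fE bilDr.
move: (bil P y (f y w)) (bil P y (g x - g y)) h1 h3 => u v h1 h3.
move: r Z r1 r_le2 Z0 h3 {r2 r0 y xE qy ax ay fE xy h2} => r Z r1 r_le2 Z0 h3.
have e1 : u + v <= Z * (r - 1) by lra.
have e2 : r * (u + v) <= r * (Z * (r - 1)) by rewrite ler_wpM2l //; lra.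
apply: le_trans e2 _.
have -> : 2 * Z * (r ^+ 2 - 1) = (2 * (r + 1)) * (Z * (r - 1)) by ring.
rewrite ler_wpM2r //; last by lra.
by rewrite mulr_ge0 ?(ltW Z0) // subr_ge0.
Qed.

Lemma field_bounded : exists2 C, 0 < C & forall x w, annulus x -> quad Q w <= 1 ->
  `|f x w| <= C.
Proof.
have [Y Y0 aY] := annulus_bounded Ppd.
have [c c0 cQ] := posdef_coercive Qpd.
have wb w : quad Q w <= 1 -> `|w| <= c + 1.
  move=> qw; have c1 : 0 <= c + 1 by lra.
  rewrite -(ler_pXn2r (ltn0Sn 1)) ?nnegrE //.
  have h : c * quad Q w <= c * 1 by rewrite ler_pM2l.
  apply: le_trans (cQ w) (le_trans h _).
  by rewrite sqrrD expr1n; have := sqr_ge0 c; lra.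
have Dw w : quad Q w <= 1 -> `|D *m w| <= p%:R * `|D| * (c + 1).
  move=> qw; apply: le_trans (mx_norm_mulmx _ _) _.
  by rewrite ler_wpM2l ?mulr_ge0 // wb.
have D0 : 0 <= p%:R * `|D| * (c + 1) by rewrite !mulr_ge0 //; lra.
(* The bound is propagated from one point of the annulus, which is empty only in dimension 0. *)
have [[y0 ay0]|noy] := pselect (exists y, annulus y); last first.
  by exists 1 => // x w ax; case: noy; exists x.
exists (`|g y0| + K * (2 * Y) + p%:R * `|D| * (c + 1)) => [|x w ax qw].
  have : 0 <= `|g y0| by [].
  have : 0 < K * (2 * Y) by rewrite !mulr_gt0.
  lra.
apply: le_trans (ler_normD _ _) _; apply: lerD; last exact: Dw.
rewrite -[g x](subrK (g y0)) addrC; apply: le_trans (ler_normD _ _) _.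
rewrite lerD2l; apply: le_trans (gK ax ay0) _.
rewrite ler_wpM2l ?(ltW K0) //; apply: le_trans (ler_normB _ _) _.
by have := aY x ax; have := aY y0 ay0; lra.
Qed.

(** Each coordinate is a constant plus a primitive of an integrable function. *)
Lemma solution_continuous_on_seg w T (x : R -> 'cV[R]_n) t1 : solution f w T x ->
  0 <= t1 -> (t1%:E < T)%E -> continuous_on_seg t1 (fun t => quad P (x t) - 1).
Proof.
move=> sol t10 t1T; apply: within_continuous_on_seg.
have cx i : {within `[0, t1], continuous (fun t => x t i 0)}.
  have [iF _] := sol t1 i t10 t1T.
  have := parameterized_integral_continuous t10 iF.
  rewrite /parameterized_integral => ci.
  have cs : {within `[0, t1], continuous (fun t => x 0 i 0 +
      \int[mu]_(s in `[0, t]) f (x s) (w s) i 0)}.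
    by move=> z; apply: cvgD; [exact: cvg_cst | exact: ci].
  apply: (subspace_eq_continuous _ cs) => z; rewrite inE /= in_itv /= => /andP[z0 z1].
  by have [] := sol z i z0 (le_lt_trans (_ : (z%:E <= t1%:E)%E) t1T).
have qE t : quad P (x t) - 1 = \sum_j (\sum_i x t i 0 * P i j) * x t j 0 - 1.
  by rewrite /quad mxE; congr (_ - _); apply: eq_bigr => j _; rewrite mxE;
    congr (_ * _); apply: eq_bigr => i _; rewrite mxE.
rewrite (_ : (fun t => _) = fun t => \sum_j (\sum_i x t i 0 * P i j) * x t j 0 - 1);
  last exact/funext.
move=> z; apply: cvgB; last exact: cvg_cst.
apply: cvg_big => [|j _]; first exact: add_continuous.
apply: cvgM; last exact: cx.
apply: cvg_big => [|i _]; first exact: add_continuous.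
by apply: cvgM; [exact: cx | exact: cvg_cst].
Qed.

(** An escaping solution has a last exit window of length at most [1 / (4 C1)]. On it a bound
    [phi <= m] improves to [phi <= m / 2]; iterating from [m = 1] forces [phi <= 0], against
    [phi t2 > 0]. *)
Lemma inward_invariant : invariant_for f Q [set x | quad P x <= 1].
Proof.
move=> w T x [_ wQ] T0 sol /= x01 t1 t10 t1T; rewrite leNgt; apply/negP => t1out.
have [b b0 bP] := bil_le P.
have [C1 C10 C1P] := outward_speed; have [C2 C20 C2P] := field_bounded.
pose phi t := quad P (x t) - 1.
have cphi := solution_continuous_on_seg sol t10 t1T.
have h0 : 0 < (4 * C1)^-1 by rewrite invr_gt0 mulr_gt0.
have [||t0 [t2 [/andP[t00 t21] /andP[t02 t2h] pt0 pt2 p01]]] :=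
  last_exit cphi h0 t10; [by rewrite subr_le0 | by rewrite subr_gt0 |].
rewrite -/(phi _) in pt0 pt2.
have {}p01 t : t0 <= t <= t2 -> 0 <= phi t <= 1 by exact: p01.
have ann t : t0 <= t <= t2 -> 1 <= quad P (x t) <= 4.
  by move=> /p01/andP[]; rewrite /phi => *; apply/andP; split; lra.
have ann' t : t0 <= t <= t2 -> annulus (x t).
  by move=> /ann/andP[? ?]; apply/andP; split; lra.
have tT t : t <= t2 -> (t%:E < T)%E.
  by move=> tt2; apply: le_lt_trans t1T; rewrite lee_fin (le_trans tt2).
have intf t i : 0 <= t -> t <= t2 ->
    mu.-integrable `[0, t] (EFin \o (fun s => f (x s) (w s) i 0)).
  by move=> t_0 tt2; have [] := sol t i t_0 (tT t tt2).
have intoc a c i : t0 <= a -> c <= t2 -> a <= c ->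
    mu.-integrable `]a, c] (EFin \o (fun s => f (x s) (w s) i 0)).
  move=> a0 c2 ac; apply: integrableS (intf c i _ c2) => //; last first.
    exact: le_trans (le_trans t00 a0) ac.
  by apply: subset_itvr; rewrite bnd_simp (le_trans t00).
have incr a c i : t0 <= a -> c <= t2 -> a <= c ->
    (x c - x a) i 0 = \int[mu]_(s in `]a, c]) f (x s) (w s) i 0.
  move=> a0 c2 ac; have a00 := le_trans t00 a0.
  rewrite -Rintegral_itv_diff //; last exact: intf (le_trans a00 ac) c2.
  have [_ xc] := sol c i (le_trans a00 ac) (tT c c2).
  have [_ xa] := sol a i a00 (tT a (le_trans ac c2)).
  by rewrite !mxE xc xa opprD addrACA subrr add0r.
have aef a c : t0 <= a -> c <= t2 ->
    {ae mu, forall s, a < s <= c -> `|f (x s) (w s)| <= C2}.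
  move=> a0 c2; apply: lebesgue_aeS wQ => s ws /andP[sa sc].
  have st : t0 <= s <= t2 by rewrite (le_trans a0 (ltW sa)) (le_trans sc).
  by apply: C2P; [exact: ann' | apply: ws; apply: le_trans (le_trans t00 a0) (ltW sa)].
have xlip a c : t0 <= a -> c <= t2 -> a <= c -> `|x c - x a| <= C2 * (c - a).
  move=> a0 c2 ac; apply: mx_norm_le => [|i j].
    by rewrite mulr_ge0 ?(ltW C20) // subr_ge0.
  rewrite (ord1 j) incr //; apply: Rintegral_ae_norm_le => //; first exact: intoc.
  apply: lebesgue_aeS (aef a c a0 c2) => s h /h.
  exact: le_trans (le_mx_norm _ _ _).
(* The increment is [2 x(a)^T P (x c - x a)] plus the form of the displacement. Replacing [x(a)] by
   [x(s)] under the integral costs [b C2^2 (c - a)^2], counted twice; the displacement adds one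
   more, whence the 3. *)
have step m : (forall t, t0 <= t <= t2 -> phi t <= m) ->
    forall a c, t0 <= a -> a <= c -> c <= t2 ->
    phi c - phi a <= 2 * C1 * m * (c - a) + 3 * (b * C2 * C2) * (c - a) ^+ 2.
  move=> phim a c a0 ac c2.
  have bE y : bil P (x a) y = \sum_i ((x a)^T *m P) 0 i * y i 0 by rewrite /bil mxE.
  have [iL eL] := @Rintegral_lincomb _ _ _ mu `]a, c] n (fun i => ((x a)^T *m P) 0 i)
    (fun i s => f (x s) (w s) i 0) (measurable_itv _) (fun i => intoc a c i a0 c2 ac).
  have d1 : bil P (x a) (x c - x a) <= (C1 * m + b * (C2 * (c - a)) * C2) * (c - a).
    rewrite bE (eq_bigr (fun i => ((x a)^T *m P) 0 i *
      \int[mu]_(s in `]a, c]) f (x s) (w s) i 0)); last by move=> i _; rewrite incr.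
    rewrite -eL; apply: Rintegral_ae_le => //.
    apply: lebesgue_aeS wQ => s ws /andP[sa sc].
    have st : t0 <= s <= t2 by rewrite (le_trans a0 (ltW sa)) (le_trans sc).
    have qw : quad Q (w s) <= 1.
      by apply: ws; apply: le_trans (le_trans t00 a0) (ltW sa).
    rewrite -bE -(subrK (x s) (x a)) addrC bilDl; apply: lerD.
      apply: le_trans (C1P _ _ (ann s st) qw) _.
      by rewrite ler_wpM2l ?(ltW C10) //; exact: phim.
    apply: le_trans (ler_norm _) (le_trans (bP _ _) _).
    apply: ler_pM => //; first by rewrite mulr_ge0 // ltW.
      rewrite ler_wpM2l ?(ltW b0) // distrC.
      have /andP[_ st2] := st.
      apply: le_trans (xlip a s a0 st2 (ltW sa)) _.
      by rewrite ler_wpM2l ?(ltW C20) // lerB.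
    by apply: C2P => //; exact: ann'.
  have d2 : quad P (x c - x a) <= b * C2 * C2 * (c - a) ^+ 2.
    apply: le_trans (ler_norm _) (le_trans (bP _ _) _).
    have xl := xlip a c a0 c2 ac.
    have := ler_pM (normr_ge0 _) (normr_ge0 _) xl xl.
    move=> /(ler_wpM2l (ltW b0)); rewrite mulrA => /le_trans; apply.
    by rewrite le_eqVlt; apply/orP; left; apply/eqP; ring.
  have -> : phi c - phi a = 2 * bil P (x a) (x c - x a) + quad P (x c - x a).
    have := quadD (x a) (x c - x a) Ppd.1; rewrite subrKC /phi => ->.
    by ring.
  apply: le_trans (lerD (ler_wpM2l (ltW (ltr0n _ 2)) d1) d2) _.
  by rewrite le_eqVlt; apply/orP; left; apply/eqP; ring.
(* Without its quadratic term [step] gives [phi t <= 2 C1 m (t - t0)], which the window length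
   bounds by [m / 2]. *)
have phik k t : t0 <= t <= t2 -> phi t <= 0 + 1 / 2 ^+ k.
  elim: k t => [|k IH] t tin; first by rewrite expr0 divr1 add0r; case/andP: (p01 t tin).
  have /andP[tt0 tt2] := tin.
  have := drop_quadratic_term (step _ IH) (lexx t0) tt0 tt2.
  rewrite pt0 subr0 add0r => /le_trans; apply.
  have c4 : 4 * C1 * (t - t0) <= 1.
    have : t - t0 <= (4 * C1)^-1 by lra.
    by rewrite -ler_pdivlMl ?mulr1 // mulr_gt0.
  have e0 : 0 <= 1 / 2 ^+ k :> R by rewrite divr_ge0 // exprn_ge0.
  have := ler_wpM2r e0 c4; rewrite mul1r.
  have -> : 1 / 2 ^+ k.+1 = 1 / 2 ^+ k / 2 :> R by rewrite exprSr invfM mulrA.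
  lra.
have t2in : t0 <= t2 <= t2 by rewrite (ltW t02) lexx.
by have := le_half_pow (fun k => phik k t2 t2in); rewrite leNgt pt2.
Qed.

End Sufficiency.

End SphereInvariance.

(** * Local solutions under a constant disturbance, and necessity of the speed condition *)

Section ConstantDisturbance.
Context {R : realType} (p : nat).
Local Notation mu := (@lebesgue_measure R).

Lemma admissible_cst (Q : 'M[R]_p) (w0 : 'cV[R]_p) : quad Q w0 <= 1 ->
  admissible Q (fun=> w0).
Proof.
move=> qw; split=> [i|]; last exact: aeW.
rewrite inE; apply/andP; split; rewrite inE /=.
  apply/(measurable_restrictT _ _).1 => //.
rewrite /finite_norm unlock /Lnorm /=; case: ifPn => // _.
apply: (@le_lt_trans _ _ `|w0 i 0|%:E); last exact: ltry.
apply/ess_supP; apply: aeW => t /=; rewrite lee_fin patchE.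
by case: ifP => //; rewrite normr0.
Qed.

End ConstantDisturbance.

Section MinMax.
Context {R : realType}.
Implicit Types a b c : R.

Lemma dist_max_le a b c : `|Num.max a c - Num.max b c| <= `|a - b|.
Proof.
have := ler_norm (a - b); have := ler_norm (b - a).
rewrite (distrC b) ler_norml; move: `|a - b| => N h1 h2.
by case: (leP a c) => ?; case: (leP b c) => ?; apply/andP; split; lra.
Qed.

Lemma dist_min_le a b c : `|Num.min a c - Num.min b c| <= `|a - b|.
Proof.
have := ler_norm (a - b); have := ler_norm (b - a).
rewrite (distrC b) ler_norml; move: `|a - b| => N h1 h2.
by case: (leP a c) => ?; case: (leP b c) => ?; apply/andP; split; lra.
Qed.

End MinMax.

Section Clamp.
Context {R : realType} (n : nat) (x0 : 'cV[R]_n) (e : R).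
Hypothesis e0 : 0 <= e.

(** A 1-Lipschitz retraction onto a box around [x0]. Composed with it, a field that is Lipschitz
    only near [x0] becomes bounded and globally Lipschitz, as Picard iteration requires. *)
Definition clamp_mx (x : 'cV[R]_n) : 'cV[R]_n :=
  \col_i Num.max (Num.min (x i 0) (x0 i 0 + e)) (x0 i 0 - e).

Lemma clamp_mx_dist x : `|clamp_mx x - x0| <= e.
Proof.
apply: mx_norm_le => // i j; rewrite (ord1 j) !mxE ler_norml.
move: (x i 0) (x0 i 0) => a b.
have := e0; case: (leP a (b + e)) => h1 h2.
  by case: (leP a (b - e)) => h3; apply/andP; split; lra.
by case: (leP (b + e) (b - e)) => h3; apply/andP; split; lra.
Qed.

Lemma clamp_mx_id x : `|x - x0| <= e -> clamp_mx x = x.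
Proof.
move=> xe; apply/colP => i; rewrite !mxE.
have := le_trans (le_mx_norm (x - x0) i 0) xe; rewrite !mxE ler_norml.
move: (x i 0) (x0 i 0) => a b /andP[? ?].
by rewrite min_l ?max_l //; lra.
Qed.

Lemma clamp_mx_lipschitz x y : `|clamp_mx x - clamp_mx y| <= `|x - y|.
Proof.
apply: mx_norm_le => // i j; rewrite (ord1 j) !mxE.
have := le_mx_norm (x - y) i 0; rewrite !mxE; apply: le_trans.
move: (x i 0) (y i 0) (x0 i 0) => a b c.
exact: le_trans (dist_max_le _ _ _) (dist_min_le _ _ _).
Qed.

End Clamp.

Section Necessity.
Context {R : realType} (n p : nat).
Local Notation mu := (@lebesgue_measure R).
Variables (P : 'M[R]_n) (Q : 'M[R]_p) (D : 'M[R]_(n, p)).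
Variables (g : 'cV[R]_n -> 'cV[R]_n) (K : R).
Hypotheses (Ppd : posdef P) (K0 : 0 < K).
Hypothesis gK : forall x y, 4^-1 <= quad P x <= 4 -> 4^-1 <= quad P y <= 4 ->
  `|g x - g y| <= K * `|x - y|.

Let f x w := g x + D *m w.

Lemma sphere_neighbourhood x0 : quad P x0 = 1 -> exists2 e, 0 < e &
  forall x, `|x - x0| <= e -> 4^-1 <= quad P x <= 4.
Proof.
move=> q0; have [b b0 bP] := bil_le P.
pose B := b * (2 * `|x0| + 1).
have B0 : 0 < B by rewrite mulr_gt0 // ltr_wpDl // mulr_ge0.
(* This gives [e <= 1] and [B e <= 1/2], so the form stays within 1/2 of its value 1 at [x0]. *)
pose e := (2 * B + 1)^-1.
have e_0 : 0 < e by rewrite invr_gt0; lra.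
have e1 : e <= 1 by rewrite invf_le1; lra.
have Be : B * e <= 2^-1.
  by rewrite ler_pdivrMr; lra.
exists e => // x xe.
have qE : quad P x - 1 = bil P (x - x0) (x + x0).
  by rewrite -q0 !quadE bilBl !bilDr (bilC x0 x Ppd.1); ring.
have h : `|quad P x - 1| <= 2^-1.
  have x1 : `|x + x0| <= 2 * `|x0| + 1.
    rewrite -[x](subrK x0) -addrA -mulr2n; apply: le_trans (ler_normD _ _) _.
    rewrite normrMn -mulr_natl; lra.
  rewrite qE; apply: le_trans (bP _ _) (le_trans _ Be).
  by rewrite /B -!mulrA ler_pM2l // mulrC ler_pM.
by move: h; rewrite ler_norml => /andP[? ?]; apply/andP; split; lra.
Qed.

(** Picard iteration solves the clamped equation. The error bound holds because the velocity at time
    [s] differs from the initial one by at most [K C s], with [C] the bound on the field. *)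
Lemma local_solution x0 w0 : quad P x0 = 1 -> exists T x C, [/\ 0 < T, 0 < C, x 0 = x0,
  solution f (fun=> w0) T%:E x &
  forall t, 0 <= t -> t < T -> `|x t - x0 - t *: f x0 w0| <= C * t ^+ 2].
Proof.
move=> q0; have [e e0 eP] := sphere_neighbourhood q0.
pose F x := f (clamp_mx x0 e x) w0.
have e00 := ltW e0.
have ann x := eP _ (clamp_mx_dist x0 e00 x).
have FK x y : `|F x - F y| <= K * `|x - y|.
  rewrite /F /f opprD addrACA subrr addr0; apply: le_trans (gK (ann x) (ann y)) _.
  by rewrite ler_wpM2l ?(ltW K0) // clamp_mx_lipschitz.
have cx0 : clamp_mx x0 e x0 = x0 by rewrite clamp_mx_id // subrr normr0.
pose C := `|f x0 w0| + K * e.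
have Fx0 : F x0 = f x0 w0 by rewrite /F cx0.
have FC x : `|F x| <= C.
  have h : `|F x - f x0 w0| <= K * e.
    rewrite -Fx0 /F /f opprD addrACA subrr addr0.
    apply: le_trans (gK (ann x) (ann x0)) _.
    by rewrite cx0 ler_wpM2l ?(ltW K0) // clamp_mx_dist.
  rewrite -[F x](subrK (f x0 w0)); apply: le_trans (ler_normD _ _) _.
  by rewrite addrC lerD2l.
have C0 : 0 < C by rewrite ltr_wpDl // mulr_gt0.
have [T' [x [T'0 xC x00 xE]]] := picard x0 K0 FK FC.
(* Moving at speed at most [C], the curve stays in the box until [e / C], so the clamp acts as the
   identity. *)
pose T := Num.min T' (e / C).
have T0 : 0 < T by rewrite lt_min T'0 divr_gt0.
have xx0 t : 0 <= t -> `|x t - x0| <= C * t.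
  by move=> t0; have := xC t 0; rewrite x00 subr0 ger0_norm.
have xid t : 0 <= t -> t < T -> F (x t) = f (x t) w0.
  move=> t0; rewrite lt_min => /andP[_ te]; rewrite /F clamp_mx_id //.
  apply: le_trans (xx0 t t0) _; rewrite mulrC -ler_pdivlMr //; exact: ltW.
have cF i : continuous (fun s => F (x s) i 0).
  exact: (field_continuous K0 FK xC).
exists T, x, (K * C); split => //; first exact: mulr_gt0.
  move=> t i t0; rewrite lte_fin => tT.
  have tT' : t < T' by apply: lt_le_trans tT _; rewrite ge_min lexx.
  have inE' s : s \in `[0, t]%classic -> F (x s) i 0 = f (x s) w0 i 0.
    rewrite inE /= in_itv /= => /andP[s0 st]; rewrite xid //.
    exact: le_lt_trans tT.
  split; last by rewrite (xE t i tT'); congr (_ + _); exact: eq_Rintegral.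
  have := continuous_integrable_itv 0 t (cF i).
  by apply: eq_integrable => // s sin /=; rewrite inE'.
move=> t t0 tT.
have tT' : t < T' by apply: lt_le_trans tT _; rewrite ge_min lexx.
have KC : 0 <= K * (C * t) by rewrite !mulr_ge0 // ltW.
rewrite expr2 mulrA -(mulrA K).
apply: mx_norm_le => [|i j]; first exact: mulr_ge0.
rewrite (ord1 j); move: (f x0 w0) Fx0 => v Fx0.
have -> : (x t - x0 - t *: v) i 0 = x t i 0 - x0 i 0 - t * v i 0 by rewrite !mxE.
rewrite (xE t i tT') x00 (addrAC (x0 i 0)) subrr add0r.
have cc : continuous (cst (v i 0) : R -> R) by move=> ?; exact: cvg_cst.
have -> : t * v i 0 = \int[mu]_(s in `[0, t]) (cst (v i 0) s).
  rewrite Rintegral_cst //= lebesgue_measure_itv /= lte_fin.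
  move: t0; rewrite le_eqVlt => /predU1P[<-|t0]; first by rewrite ltxx mulr0 mul0r.
  by rewrite t0 /= subr0 mulrC.
apply: (primitive_dist (cF i) cc KC t0 (lexx t)) => s s0 st.
have -> : F (x s) i 0 - cst (v i 0) s = (F (x s) - F x0) i 0.
  by rewrite Fx0; move: (F (x s)) => u; rewrite !mxE.
apply: le_trans (le_mx_norm _ _ _) (le_trans (FK _ _) _).
rewrite ler_wpM2l ?(ltW K0) //.
by apply: le_trans (xx0 s s0) _; rewrite ler_wpM2l // ltW.
Qed.

(** A positive speed [eta] at a boundary point would give [x^T P x >= 1 + 2 t eta - O(t^2)] along
    the local solution, which exceeds 1 for small [t]. *)
Lemma invariant_inward : invariant_for f Q [set x | quad P x <= 1] ->
  forall x w, quad P x = 1 -> quad Q w <= 1 -> bil P x (f x w) <= 0.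
Proof.
move=> inv x0 w0 q0 qw; rewrite leNgt; apply/negP => out.
have [b b0 bP] := bil_le P.
have [T [x [C [T0 C0 x00 sol xt]]]] := local_solution w0 q0.
have X1 : 0 < b * `|x0| * C + 1 by rewrite ltr_wpDl // !mulr_ge0 // ltW.
set eta := bil P x0 (f x0 w0) in out.
(* Within the lifespan, and small enough for the second-order error to be below [t eta]. *)
pose t := Num.min (T / 2) (eta / (2 * (b * `|x0| * C + 1))).
have t0 : 0 < t by rewrite lt_min !divr_gt0 // mulr_gt0.
have tT : t < T.
  have : t <= T / 2 by rewrite ge_min lexx.
  lra.
have te : (b * `|x0| * C + 1) * t <= eta / 2.
  have : t <= eta / (2 * (b * `|x0| * C + 1)) by rewrite ge_min lexx orbT.
  rewrite ler_pdivlMr ?mulr_gt0 //; lra.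
have T0' : (0 < T%:E)%E by rewrite lte_fin.
have tT'' : (t%:E < T%:E)%E by rewrite lte_fin.
have := inv _ _ x (admissible_cst qw) T0' sol _ t (ltW t0) tT''.
rewrite /= x00 q0 lexx => /(_ isT).
have := quadD x0 (x t - x0) Ppd.1; rewrite subrKC q0 => ->.
have := quad_ge0 (x t - x0) Ppd.
have h := xt t (ltW t0) tT.
have : bil P x0 (x t - x0) = t * eta + bil P x0 (x t - x0 - t *: f x0 w0).
  by rewrite [in RHS]bilBr bilZr /eta; ring.
have := le_trans (bP x0 _) (ler_wpM2l (_ : 0 <= b * `|x0|) h).
rewrite mulr_ge0 ?(ltW b0) // => /(_ isT).
rewrite ler_norml => /andP[h1 _].
have : b * `|x0| * (C * t ^+ 2) < t * eta.
  rewrite (_ : _ * (C * _) = t * (b * `|x0| * C * t)); last by ring.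
  rewrite ltr_pM2l //; lra.
lra.
Qed.

End Necessity.

(** * The closed-loop field near the unit sphere *)

Section ClosedLoop.
Context {R : realType} (n m : nat).
Variables (A : 'M[R]_n) (B : 'M[R]_(n, m)) (G0 : 'M[R]_n) (Y0 : 'M[R]_(m, n)).
Variables (mu : R) (X : 'M[R]_n) (Y : 'M[R]_(m, n)).

Let G := gen_d mu G0.
Let P := invmx X.
Hypotheses (Ppd : posdef P) (PGpd : posdef (P *m G + G^T *m P)).

Definition closed_loop (x : 'cV[R]_n) : 'cV[R]_n :=
  A *m x + B *m homogeneous_control G0 Y0 mu X Y x.

(** The nonlinear part of the closed loop at a point of homogeneous norm [exp s], as a matrix that
    depends on the point through [s] alone. *)
Definition feedback_gain (s : R) : 'M[R]_n :=
  expR ((mu + 1) * s) *: (B *m gain_K X Y *m dilation G (- s)).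

Lemma closed_loopE x : x != 0 -> closed_loop x =
  mat_A0 A B G0 Y0 *m x + feedback_gain (hlog (dilation G) P x) *m x.
Proof.
move=> x0; rewrite /closed_loop /homogeneous_control (negbTE x0) hnormE // -/G -/P.
set s := hlog _ _ _.
have -> : powR (expR s) (mu + 1) = expR ((mu + 1) * s).
  by rewrite /powR gt_eqF ?expR_gt0 // expRK.
rewrite expRK mulmxDr addrA /mat_A0 mulmxDl !mulmxA; congr (_ + _).
by rewrite /feedback_gain -scalemxAr -scalemxAl !mulmxA.
Qed.

Lemma closed_loop_sphere x : quad P x = 1 ->
  closed_loop x = (mat_A0 A B G0 Y0 + B *m gain_K X Y) *m x.
Proof.
move=> q1; have x0 : x != 0.
  by apply/eqP => x0; move: q1; rewrite x0 quad0 => /esym/eqP; rewrite oner_eq0.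
rewrite closed_loopE // hlog_sphere // /feedback_gain oppr0 dilation0 mulr0.
by rewrite expR0 scale1r mulmx1 -mulmxDl.
Qed.

(** On [|s| <= S] the scalar factor and the matrix factor are both bounded and Lipschitz, hence so
    is their product. *)
Lemma feedback_gain_bounds S : exists2 C, 0 < C & (forall s, `|s| <= S ->
  `|feedback_gain s| <= C) /\ (forall s t, `|s| <= S -> `|t| <= S ->
  `|feedback_gain s - feedback_gain t| <= C * `|s - t|).
Proof.
pose e s := expR ((mu + 1) * s); pose de s := e s * (mu + 1).
have ed s : is_derive s (1 : R) e (de s).
  apply: (@is_derive1_comp _ expR (fun t => (mu + 1) * t)).
  have := @is_deriveZ _ _ _ id (mu + 1) s 1 _ (is_derive_id _ _).
  by move=> /is_derive_eq; apply; rewrite /GRing.scale /= mulr1.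
have ce := is_derive_continuous ed.
have [Ce eC] := continuous_bounded S ce.
have [Cd Cd0 dC] := dilation_bounded G S; have [L L0 dL] := dilation_lipschitz G S.
pose BK := n%:R * `|B *m gain_K X Y|.
have BK0 : 0 <= BK by rewrite mulr_ge0.
have Mb s : `|s| <= S -> `|B *m gain_K X Y *m dilation G (- s)| <= BK * Cd.
  move=> sS; apply: le_trans (mx_norm_mulmx _ _) _.
  by rewrite ler_wpM2l // dC // normrN.
have ML s t : `|s| <= S -> `|t| <= S -> `|B *m gain_K X Y *m dilation G (- s) -
    B *m gain_K X Y *m dilation G (- t)| <= BK * L * `|s - t|.
  move=> sS tS; rewrite -mulmxBr; apply: le_trans (mx_norm_mulmx _ _) _.
  rewrite -/BK -[leRHS]mulrA ler_wpM2l //.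
  have : `|- s - - t| <= `|s - t| by rewrite -opprD normrN.
  by move=> /(ler_wpM2l (ltW L0)); apply: le_trans; rewrite dL // normrN.
have eL : forall s t, `|s| <= S -> `|t| <= S ->
    `|e s - e t| <= `|Ce| * `|mu + 1| * `|s - t|.
  apply: (is_derive_lipschitz ed) => s sS.
  by rewrite normrM ler_wpM2r // (le_trans (eC s sS)) // ler_norm.
pose C1 := `|Ce| * (BK * Cd); pose C2 := `|Ce| * `|mu + 1| * (BK * Cd).
pose C3 := `|Ce| * (BK * L).
have C10 : 0 <= C1 by rewrite !mulr_ge0 // ltW.
have C20 : 0 <= C2 by rewrite !mulr_ge0 // ltW.
have C30 : 0 <= C3 by rewrite !mulr_ge0 // ltW.
have eC' s : `|s| <= S -> `|e s| <= `|Ce|.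
  by move=> sS; rewrite (le_trans (eC s sS)) // ler_norm.
exists (C1 + C2 + C3 + 1); first by rewrite ltr_wpDl // !addr_ge0.
split=> [s sS|s t sS tS].
  rewrite /feedback_gain normrZ.
  have := ler_pM (normr_ge0 _) (normr_ge0 _) (eC' s sS) (Mb s sS).
  by rewrite -/C1; move=> /le_trans; apply; lra.
rewrite /feedback_gain -/(e s) -/(e t).
set Ms := _ *m dilation G (- s); set Mt := _ *m dilation G (- t).
have -> : e s *: Ms - e t *: Mt = (e s - e t) *: Ms + e t *: (Ms - Mt).
  by rewrite scalerBl scalerBr addrA subrK.
apply: le_trans (ler_normD _ _) _; rewrite !normrZ.
have h1 := ler_pM (normr_ge0 _) (normr_ge0 _) (eL s t sS tS) (Mb s sS).
have h2 := ler_pM (normr_ge0 _) (normr_ge0 _) (eC' t tS) (ML s t sS tS).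
apply: le_trans (lerD h1 h2) _.
have -> : `|Ce| * `|mu + 1| * `|s - t| * (BK * Cd) = C2 * `|s - t| by rewrite /C2; ring.
have -> : `|Ce| * (BK * L * `|s - t|) = C3 * `|s - t| by rewrite /C3; ring.
rewrite -mulrDl ler_wpM2r //; lra.
Qed.

Lemma closed_loop_lipschitz : exists2 K, 0 < K & forall x y,
  4^-1 <= quad P x <= 4 -> 4^-1 <= quad P y <= 4 ->
  `|closed_loop x - closed_loop y| <= K * `|x - y|.
Proof.
have [S S0 hS] := hlog_bounded Ppd PGpd; have [L L0 hL] := hlog_lipschitz Ppd PGpd.
have [Z Z0 aZ] := annulus_bounded Ppd; have [C C0 [fC fL]] := feedback_gain_bounds S.
pose A0 := mat_A0 A B G0 Y0; pose N : R := n%:R.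
have N0 : 0 <= N by [].
have LZ0 : 0 <= C * (L * Z) by rewrite !mulr_ge0 // ltW.
have K0 : 0 <= N * (`|A0| + C * (L * Z) + C).
  by rewrite mulr_ge0 // !addr_ge0 // ltW.
exists (N * (`|A0| + C * (L * Z) + C) + 1) => [|x y ax ay]; first lra.
rewrite (closed_loopE (annulus_neq0 ax)) (closed_loopE (annulus_neq0 ay)) -/A0.
have sS := hS x ax; have tS := hS y ay; have st := hL x y ax ay.
move: (hlog _ _ x) (hlog _ _ y) sS tS st => s t sS tS st.
(* In the middle term the gain difference is controlled by [hlog_lipschitz], and [x] is bounded in
   the annulus. *)
have -> : A0 *m x + feedback_gain s *m x - (A0 *m y + feedback_gain t *m y) =
    A0 *m (x - y) + (feedback_gain s - feedback_gain t) *m x + feedback_gain t *m (x - y).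
  by rewrite !mulmxBr mulmxBl -[RHS]addrA subrKA opprD addrACA.
have h1 : `|A0 *m (x - y)| <= N * `|A0| * `|x - y| by exact: mx_norm_mulmx.
have h2 : `|(feedback_gain s - feedback_gain t) *m x| <= N * (C * (L * Z)) * `|x - y|.
  apply: le_trans (mx_norm_mulmx _ _) _.
  have e1 := le_trans (fL s t sS tS) (ler_wpM2l (ltW C0) st).
  have e2 := ler_pM (normr_ge0 _) (normr_ge0 _) e1 (aZ x ax).
  rewrite -mulrA; apply: le_trans (ler_wpM2l N0 e2) _.
  by rewrite le_eqVlt; apply/orP; left; apply/eqP; ring.
have h3 : `|feedback_gain t *m (x - y)| <= N * C * `|x - y|.
  apply: le_trans (mx_norm_mulmx _ _) _.
  by rewrite ler_wpM2r // ler_wpM2l // fC.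
apply: le_trans (ler_normD _ _) (le_trans (lerD (ler_normD _ _) (lexx _)) _).
apply: le_trans (lerD (lerD h1 h2) h3) _.
have : 0 <= `|x - y| by []; move: `|x - y| => r r0.
rewrite -!mulrDl ler_wpM2r //; lra.
Qed.

End ClosedLoop.

(** * From the speed condition to the matrix inequality *)

Section MatrixInequality.
Context {R : realType} (n p : nat).
Variables (S X : 'M[R]_n) (D : 'M[R]_(n, p)) (Q : 'M[R]_p).
Hypotheses (Xpd : posdef X) (Qpd : posdef Q) (symS : S^T = S).

Lemma quad_block_mx (U : 'M[R]_n) (V : 'M[R]_(n, p)) (W : 'M[R]_p) x w :
  quad (block_mx U V V^T W) (col_mx x w) = quad U x + 2 * bil V x w + quad W w.
Proof.
have addE (a b : 'M[R]_1) : (a + b) 0 0 = a 0 0 + b 0 0 by rewrite mxE.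
rewrite /quad tr_col_mx mul_row_block mul_row_col !mulmxDl !addE addrA.
have -> : (w^T *m V^T *m x) 0 0 = bil V x w by rewrite -/(bil V^T w x) bil_tr trmxK.
by rewrite -/(bil V x w) -/(bil U x x) -/(bil W w w); ring.
Qed.

Lemma block_mx_sym (U : 'M[R]_n) (V : 'M[R]_(n, p)) (W : 'M[R]_p) :
  U^T = U -> W^T = W -> (block_mx U V V^T W)^T = block_mx U V V^T W.
Proof. by move=> sU sW; rewrite tr_block_mx sU sW trmxK. Qed.

Lemma quad_lmi b x w :
  quad (block_mx (S + b *: X) D D^T (- (b *: Q))) (col_mx x w) =
  quad S x + 2 * bil D x w + b * (quad X x - quad Q w).
Proof.
rewrite quad_block_mx !quadE bil_mxD bil_mxN !bil_mxZ; ring.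
Qed.

(** By scaling, the condition on the sphere extends to all pairs with [w^T Q w <= x^T X x]; the
    S-lemma then yields a multiplier [b >= 0]. Conversely, [b (1 - w^T Q w)] is nonnegative on
    admissible values. *)
Lemma lmi_iff : D != 0 ->
  (forall x w, quad X x = 1 -> quad Q w <= 1 -> quad S x + 2 * bil D x w <= 0) <->
  exists2 b, 0 < b & negsemidef (block_mx (S + b *: X) D D^T (- (b *: Q))).
Proof.
move=> D0; split=> [inw|[b b0 [_ nsd]] x w qx qw]; last first.
  have := nsd (col_mx x w); rewrite quad_lmi qx.
  have : b * (1 - quad Q w) >= 0 by rewrite mulr_ge0 ?(ltW b0) // subr_ge0.
  lra.
have [i [j Dij]] : exists i j, D i j != 0.
  apply: contrapT => nD; case/negP: D0; apply/eqP/matrixP => i j.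
  by rewrite mxE; apply/eqP/negPn/negP => Dij; apply: nD; exists i, j.
pose ei : 'cV[R]_n := delta_mx i 0; pose ej : 'cV[R]_p := delta_mx j 0.
have ei0 : ei != 0.
  by apply/eqP => /matrixP/(_ i 0); rewrite !mxE !eqxx => /eqP; rewrite oner_eq0.
have Dij_bil : bil D ei ej = D i j by rewrite /bil trmx_delta -rowE -colE !mxE.
pose F := block_mx S D D^T 0; pose G := block_mx X 0 0^T (- Q).
have FE x w : quad F (col_mx x w) = quad S x + 2 * bil D x w.
  by rewrite quad_block_mx [quad 0 w]quadE bil_mx0 addr0.
have GE x w : quad G (col_mx x w) = quad X x - quad Q w.
  by rewrite quad_block_mx bil_mx0 mulr0 addr0 [quad (- Q) w]quadE bil_mxN.
have symF : F^T = F by apply: block_mx_sym => //; rewrite trmx0.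
have symG : G^T = G by apply: block_mx_sym; rewrite ?linearN /= ?Xpd.1 ?Qpd.1.
have FG z : 0 <= quad G z -> quad F z <= 0.
  rewrite -(vsubmxK z) FE GE; move: (usubmx z) (dsubmx z) => x w.
  have [->|x0] := eqVneq x 0.
    rewrite quad0 sub0r oppr_ge0 => qw.
    have [->|w0] := eqVneq w 0.
      by rewrite quad0 /bil mulmx0 mxE mulr0 addr0.
    by have := Qpd.2 w w0; lra.
  rewrite subr_ge0 => qwx; have qx := Xpd.2 x x0.
  (* Dividing both [x] and [w] by [r] puts [x] on the sphere and keeps the sign of the inequality,
     which is homogeneous of degree two. *)
  pose r := Num.sqrt (quad X x); have r0 : 0 < r by rewrite sqrtr_gt0.
  have r2 : r ^+ 2 = quad X x by rewrite sqr_sqrtr // ltW.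
  have := inw (r^-1 *: x) (r^-1 *: w); rewrite !quadZ bilZl bilZr.
  rewrite -r2 exprVn mulVf ?expf_neq0 ?gt_eqF // => /(_ erefl).
  have ri : 0 < (r ^+ 2)^-1 by rewrite invr_gt0 exprn_gt0.
  rewrite mulrC ler_pdivrMr ?exprn_gt0 // mul1r r2 => /(_ qwx).
  rewrite (_ : _ + _ = (r ^+ 2)^-1 * (quad S x + 2 * bil D x w)).
    by rewrite pmulr_rle0 // -r2.
  by rewrite -r2; field; rewrite gt_eqF.
have [|b b0 bP] := S_lemma symF symG FG.
  by exists (col_mx ei 0); rewrite GE quad0 subr0; exact: Xpd.2.
have bP' x w : quad S x + 2 * bil D x w + b * (quad X x - quad Q w) <= 0.
  by have := bP (col_mx x w); rewrite FE GE.
exists b; last split.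
(* With [b = 0] the disturbance would be unrestricted; along [ej] it can be scaled so that the term
   in [D] equals [2 (|ei^T S ei| + 1)], which makes the sum positive. *)
- rewrite lt_neqAle b0 andbT; apply/eqP => b_0.
  have := bP' ei (((`|quad S ei| + 1) / D i j) *: ej).
  rewrite -b_0 mul0r addr0 bilZr Dij_bil divfK //.
  have := ler_norm (- quad S ei); rewrite normrN.
  have := normr_ge0 (quad S ei); lra.
- apply: block_mx_sym; rewrite ?linearN ?linearD ?linearZ /= ?symS ?Xpd.1 ?Qpd.1 //.
- by move=> z; rewrite -(vsubmxK z) quad_lmi.
Qed.

End MatrixInequality.

(** * Congruence, the Lyapunov expression, and the equivalence *)

(** Taken with [U = X^-1], it carries positivity from [X] to [P] and from [G X + X G^T] to
    [P G + G^T P]. *)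
Lemma posdef_congr (R : realType) n (M U : 'M[R]_n) : U \in unitmx ->
  posdef M -> posdef (U^T *m M *m U).
Proof.
move=> uU Mpd; split; first by rewrite !trmx_mul trmxK Mpd.1 mulmxA.
move=> x x0; rewrite quadE -bil_mulmx; apply: Mpd.2.
by apply: contra x0 => /eqP Ux; rewrite -[x](mulKmx uU) Ux mulmx0.
Qed.

Lemma lyapunov_operatorE (R : realType) n m (A X : 'M[R]_n) (B : 'M[R]_(n, m))
    (K : 'M[R]_(m, n)) : X^T = X ->
  A *m X + X *m A^T + B *m (K *m X) + (K *m X)^T *m B^T =
  (A + B *m K) *m X + ((A + B *m K) *m X)^T.
Proof.
move=> sX; rewrite mulmxDl linearD /= !trmx_mul sX -!mulmxA -addrA.
by rewrite addrACA.
Qed.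

Theorem theoremV1 (R : realType) (n m p : nat)
    (A : 'M[R]_n) (B : 'M[R]_(n, m)) (D : 'M[R]_(n, p)) (Q : 'M[R]_p)
    (G0 : 'M[R]_n) (Y0 : 'M[R]_(m, n)) (mu : R)
    (X : 'M[R]_n) (Y' : 'M[R]_(m, n)) (dw : R -> 'M[R]_p) :
  (3 <= n)%N -> nilpotent_mx A -> D != 0 -> controllable A B -> posdef Q ->
  homogeneous_design A B G0 Y0 mu X Y' ->
  is_dilation dw ->
  let Gd := gen_d mu G0 in
  let d := dilation Gd in
  let A0 := mat_A0 A B G0 Y0 in
  let K := gain_K X Y' in
  let u := homogeneous_control G0 Y0 mu X Y' in
  let f := plant A B D u in
  homogeneous_field (fun s => block_mx (d s) 0 0 (dw s)) mu
    (extended_field f) ->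
  invariant_for f Q (hellipsoid d (invmx X)) <->
  exists2 beta : R, 0 < beta &
    let Y := K *m X in
    [/\ negsemidef (block_mx
          (A0 *m X + X *m A0^T + B *m Y + Y^T *m B^T + beta *: X) D
          D^T (- (beta *: Q))),
        posdef (Gd *m X + X *m Gd^T) &
        posdef X].
Proof.
move=> _ _ D0 _ Qpd design _ Gd d A0 K u f _.
have Xpd := design_X design; have GXpd := design_monotone design.
have Xu := posdef_unitmx Xpd; have sX := Xpd.1.
pose P := invmx X; have sP : P^T = P by rewrite trmx_inv sX.
have Pu : P \in unitmx by rewrite unitmx_inv.
have Ppd : posdef P.
  by have := posdef_congr Pu Xpd; rewrite sP mulVmx // mul1mx.
have PGpd : posdef (P *m Gd + Gd^T *m P).
  have := posdef_congr Pu GXpd; rewrite sP mulmxDr mulmxDl !mulmxA -/Gd.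
  by rewrite mulVmx // mul1mx mulmxK.
pose M := A0 + B *m K.
pose S := A0 *m X + X *m A0^T + B *m (K *m X) + (K *m X)^T *m B^T.
have SE : S = M *m X + (M *m X)^T.
  exact: lyapunov_operatorE.
have symS : S^T = S by rewrite SE linearD /= trmxK addrC.
(* In the dual variable the state is [X *m x], and [P] cancels against [X]. *)
have speedE x w : 2 * bil P (X *m x) (M *m (X *m x) + D *m w) = quad S x + 2 * bil D x w.
  rewrite bilDr mulmxA !bil_mulmx sX mulmxV // !mul1mx.
  by rewrite SE quadE bil_mxD [bil (_^T) x x]bil_tr trmxK; ring.
have quadP x : quad P (X *m x) = quad X x.
  by rewrite !quadE bil_mulmx sX mulmxV // mul1mx.
have [k k0 gk] := closed_loop_lipschitz A B Y0 Y' Ppd PGpd.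
have ellE : hellipsoid d P = [set x | quad P x <= 1].
  by apply/seteqP; split => x /(hellipsoidE Ppd PGpd).
(* On the sphere the closed loop is the linear map [M], and multiplication by [X] carries the sphere
   of [X] onto that of [P]. *)
have inwardE : (forall x w, quad P x = 1 -> quad Q w <= 1 ->
    bil P x (closed_loop A B G0 Y0 mu X Y' x + D *m w) <= 0) <->
  (forall x w, quad X x = 1 -> quad Q w <= 1 -> quad S x + 2 * bil D x w <= 0).
  split=> inw x w qx qw.
    rewrite -speedE pmulr_rle0 // -(closed_loop_sphere A B Y0 Y' Ppd PGpd) ?quadP //.
    by apply: inw => //; rewrite quadP.
  rewrite (closed_loop_sphere A B Y0 Y' Ppd PGpd) // -/M.
  have xE : x = X *m (P *m x) by rewrite mulKVmx.
  rewrite xE -(pmulr_rle0 _ (ltr0n R 2)) speedE.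
  by apply: inw => //; rewrite -quadP -xE.
rewrite -/P ellE; have lmi := lmi_iff Xpd Qpd symS D0.
split=> [inv|[b b0 [nsd _ _]]].
  have /inwardE/lmi[b b0 nsd] := invariant_inward Ppd k0 gk inv.
  by exists b.
apply: (inward_invariant Ppd Qpd k0 gk); apply/inwardE/lmi; exists b => //.
Qed.
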